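(* Let $\mathbb T_n^2$ be the $2$-dimensional $n\times n$ discrete torus and let $M^{\mathbb T}(n)$ denote the maximum percolation time of a set percolating $\mathbb T_n^2$ in $2$-neighbour bootstrap percolation. Then $M^{\mathbb T}(n)=\frac{13}{18}n^2+O(n)$ as $n\to\infty$.
   Context: $\mathbb T_n^2$ has vertex set $\mathbb Z_n\times\mathbb Z_n$, two vertices adjacent iff they differ by $\pm1 \pmod n$ in exactly one coordinate and agree in the other. In $2$-neighbour bootstrap percolation from $A_0=A$, $A_t=A_{t-1}\cup\{v: v\text{ has at least 2 neighbours in }A_{t-1}\}$; $A$ percolates if eventually all vertices are infected, and its percolation time is the least $T$ with $A_T$ the whole vertex set. *)

(* Defs.v *)
From mathcomp Require Import all_boot all_order all_algebra.
From mathcomp Require Import all_classical all_reals all_analysis.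
Set Implicit Arguments.
Unset Strict Implicit.
Unset Printing Implicit Defensive.

Definition torus (n : nat) : finType := ('I_n * 'I_n)%type.

(* [ordS i] is [i + 1] modulo [n]. The condition [i != j] only matters for
   [n = 1], where it rules out a loop. *)
Definition cycle_adj (n : nat) : rel 'I_n :=
  fun i j => (i != j) && ((j == ordS i) || (i == ordS j)).

Definition torus_adj (n : nat) : rel (torus n) :=
  fun u v => (cycle_adj u.1 v.1 && (u.2 == v.2))
          || ((u.1 == v.1) && cycle_adj u.2 v.2).

Section Bootstrap.
Variables (V : finType) (e : rel V) (r : nat).

Definition bootstrap_step (A : {set V}) : {set V} :=
  A :|: [set v | r <= #|[set u in A | e v u]|].

Definition infected (A : {set V}) (t : nat) : {set V} :=
  iter t bootstrap_step A.

Definition percolates (A : {set V}) : Prop :=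
  exists t, infected A t == [set: V].

(* Junk value 0 if [A] does not percolate. *)
Definition percolation_time (A : {set V}) : nat :=
  if pselect (percolates A) is left pA then ex_minn pA else 0.

Definition max_percolation_time : nat :=
  \max_(A : {set V} | `[< percolates A >]) percolation_time A.

End Bootstrap.

Definition MT (n : nat) : nat := max_percolation_time (@torus_adj n) 2.

(* Main.v *)
From Stdlib Require Import ZArith Lia Classical.
From mathcomp Require Import all_boot.
Set Implicit Arguments.
Unset Strict Implicit.
Unset Printing Implicit Defensive.

(** Lift the torus to Z^2, where the initial set becomes [n]-periodic.  A
    rectangle is spanned if the initially infected cells inside it eventually
    fill it.

    Upper bound.  A spanned rectangle is the hull of two smaller spanned ones at
    distance at most 2, and their merger takes about the length of the side along
    which the larger one grows.  The potential [phi a b], equal for [a >= b] to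
    [18 a b - 9 b^2] if [a >= 3 b] and to [12 a b + a^2] otherwise, pays for 18
    times this cost whenever the semi-perimeter grows by at least 2.  Growth by a
    single line is too expensive on its own, but the cell that triggers it is
    either far from the two rectangles of the preceding merger, whose surplus then
    pays for both, or close to one of them, in which case the two growths happen
    in parallel.  Hence an [a x b] rectangle is filled in time
    [phi a b / 18 + O(a + b)], and [phi n n = 13 n^2].  Once a rectangle winds
    around the torus, its translates form a band, and a new row fills from both
    sides in time [n / 2], which is less than its price.

    Lower bound.  The extremal trajectory starts from a flat block of width [2n/3],
    grows by one in both directions through seeds alternately at its two upper
    corners until it is [n x n/3], and then repeatedly by three rows, two swept from
    left to right and one back. *)

Section Plane.
Local Open Scope Z_scope.
Implicit Types (A B P : Z -> Z -> Prop) (x y t s : Z).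

Definition two_nbrs P x y : Prop :=
  (P (x-1) y /\ P (x+1) y) \/ (P x (y-1) /\ P x (y+1)) \/
  (P (x-1) y /\ P x (y-1)) \/ (P (x-1) y /\ P x (y+1)) \/
  (P (x+1) y /\ P x (y-1)) \/ (P (x+1) y /\ P x (y+1)).

Fixpoint plane_iter A (k : nat) x y : Prop :=
  match k with
  | O => A x y
  | S k' => plane_iter A k' x y \/ two_nbrs (plane_iter A k') x y
  end.

Definition plane_infected A t := plane_iter A (Z.to_nat t).

Lemma two_nbrs_mono P Q x y :
  (forall u v, P u v -> Q u v) -> two_nbrs P x y -> two_nbrs Q x y.
Proof. unfold two_nbrs; intros H; intuition auto 10. Qed.

Lemma infected_invariant A P : (forall x y, A x y -> P x y) ->
  (forall x y, two_nbrs P x y -> P x y) ->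
  forall t x y, plane_infected A t x y -> P x y.
Proof.
intros HA HP t; unfold plane_infected; generalize (Z.to_nat t); intros k.
induction k as [|k IH]; simpl; auto.
intros x y [H|H]; auto; apply HP; revert H; apply two_nbrs_mono; auto.
Qed.

Lemma infected_step A t x y : 0 <= t -> two_nbrs (plane_infected A t) x y ->
  plane_infected A (t+1) x y.
Proof.
intros Ht H; unfold plane_infected; replace (Z.to_nat (t+1)) with (S (Z.to_nat t)) by lia.
simpl; auto.
Qed.

Lemma infected_le A t t' x y : t <= t' -> plane_infected A t x y -> plane_infected A t' x y.
Proof.
intros Ht; unfold plane_infected.
replace (Z.to_nat t') with (Nat.add (Z.to_nat t' - Z.to_nat t)%coq_nat (Z.to_nat t))
  by lia.
generalize (Z.to_nat t' - Z.to_nat t)%coq_nat; intros k H.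
induction k as [|k IH]; simpl; auto.
Qed.

Lemma infected_init A t x y : A x y -> plane_infected A t x y.
Proof.
intros H; apply (@infected_le _ (Z.min t 0)); try lia.
unfold plane_infected; replace (Z.to_nat (Z.min t 0)) with O by lia; exact H.
Qed.

Lemma infected0 A x y : plane_infected A 0 x y -> A x y.
Proof. exact (fun H => H). Qed.

Lemma infected_sub A B t x y : (forall u v, A u v -> B u v) ->
  plane_infected A t x y -> plane_infected B t x y.
Proof.
intros H; unfold plane_infected; generalize (Z.to_nat t); intros k; revert x y.
induction k as [|k IH]; simpl; auto.
intros x y [H1|H1]; auto; right; revert H1; apply two_nbrs_mono; auto.
Qed.

Lemma infected_comp A t s x y : 0 <= t -> 0 <= s ->
  plane_infected (plane_infected A t) s x y -> plane_infected A (t+s) x y.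
Proof.
intros Ht Hs H; rewrite -(Z2Nat.id s) // in H *; revert H.
generalize (Z.to_nat s); clear s Hs; intros k; revert x y.
induction k as [|k IH]; intros x y H.
  replace (t + Z.of_nat 0) with t by lia; exact H.
unfold plane_infected in H; rewrite Nat2Z.id in H; simpl in H.
replace (t + Z.of_nat k.+1) with (t + Z.of_nat k + 1) by lia.
unfold plane_infected in IH; rewrite Nat2Z.id in IH.
destruct H as [H|H]; [apply (@infected_le _ (t + Z.of_nat k)); [lia|exact (IH _ _ H)] |].
apply infected_step; [lia|]; revert H; apply two_nbrs_mono; exact IH.
Qed.

Lemma infected_ext A B t x y : (forall u v, A u v <-> B u v) ->
  plane_infected A t x y -> plane_infected B t x y.
Proof. intros H; apply infected_sub; intros u v; apply H. Qed.

(** * Rectangles *)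

Record rect := Rect { xl : Z; xh : Z; yl : Z; yh : Z }.
Implicit Types R Q X Y : rect.

Definition inside R x y := xl R <= x <= xh R /\ yl R <= y <= yh R.
Definition valid R := xl R <= xh R /\ yl R <= yh R.
Definition width R := xh R - xl R + 1.
Definition height R := yh R - yl R + 1.
Definition gap l h l' h' := Z.max 0 (Z.max (l' - h) (l - h')).
Definition near X Y :=
  gap (xl X) (xh X) (xl Y) (xh Y) + gap (yl X) (yh X) (yl Y) (yh Y) <= 2.
Definition subrect X Y := [/\ xl Y <= xl X, xh X <= xh Y, yl Y <= yl X & yh X <= yh Y].
Definition hull X Y :=
  Rect (Z.min (xl X) (xl Y)) (Z.max (xh X) (xh Y))
       (Z.min (yl X) (yl Y)) (Z.max (yh X) (yh Y)).
Definition cell x y := Rect x x y y.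

Ltac rlia := unfold near, inside, valid, width, height, gap, subrect, hull, cell in *;
  simpl in *; lia.

Lemma rect_eq X Y : xl X = xl Y -> xh X = xh Y -> yl X = yl Y -> yh X = yh Y -> X = Y.
Proof. destruct X, Y; simpl; intros; subst; reflexivity. Qed.

Lemma rect_closed R x y : two_nbrs (inside R) x y -> inside R x y.
Proof. unfold two_nbrs, inside; lia. Qed.

Definition fill_dist X Y x y :=
  gap x x (xl Y) (xh Y) + gap y y (yl X) (yh X).

(* A column (row) strictly between [X] and [Y] exists only when they are at
   distance 2 in that direction, and then the other projections overlap. *)
Definition fill_dom X Y x y :=
  (xl X <= x <= xh X \/ xh X < x < xl Y \/ xh Y < x < xl X) /\
  (yl Y <= y <= yh Y \/ yh X < y < yl Y \/ yh Y < y < yl X).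

Lemma gap_toward x l h : ~ (l <= x <= h) -> l <= h ->
  let x' := if Z.ltb x l then x + 1 else x - 1 in
  gap x x l h = gap x' x' l h + 1 /\ 1 <= gap x x l h.
Proof. unfold gap; simpl; destruct (Z.ltb_spec x l); lia. Qed.

Lemma near_gap_row X Y y : near X Y -> yh X < y < yl Y \/ yh Y < y < yl X ->
  xl Y <= xh X /\ xl X <= xh Y.
Proof. unfold near, gap; intros n [d|d]; clear -n d; lia. Qed.

Lemma near_gap_col X Y x : near X Y -> xh X < x < xl Y \/ xh Y < x < xl X ->
  yl Y <= yh X /\ yl X <= yh Y.
Proof. unfold near, gap; intros n [d|d]; clear -n d; lia. Qed.

Lemma fill_dom_toward X Y x y : valid X -> valid Y -> near X Y -> fill_dom X Y x y ->
  ~ (xl Y <= x <= xh Y) ->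
  let x' := if Z.ltb x (xl Y) then x + 1 else x - 1 in
  fill_dom X Y x' y \/ inside Y x' y.
Proof.
intros [vx _] [vx' _] n [dx [dy|dy]] e; unfold fill_dom, inside.
- clear n; simpl; destruct (Z.ltb_spec x (xl Y)).
    destruct (Z.eq_dec (x+1) (xl Y)); [right|left]; lia.
  destruct (Z.eq_dec (x-1) (xh Y)); [right|left]; lia.
- destruct (near_gap_row n dy) as [n1 n2]; clear n.
  left; split; [simpl; destruct (Z.ltb_spec x (xl Y)); lia | tauto].
Qed.

Lemma fill_dom_toward' X Y x y : valid X -> valid Y -> near X Y -> fill_dom X Y x y ->
  ~ (yl X <= y <= yh X) ->
  let y' := if Z.ltb y (yl X) then y + 1 else y - 1 in
  fill_dom X Y x y' \/ inside X x y'.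
Proof.
intros [_ vy] [_ vy'] n [[dx|dx] dy] e; unfold fill_dom, inside.
- clear n; simpl; destruct (Z.ltb_spec y (yl X)).
    destruct (Z.eq_dec (y+1) (yl X)); [right|left]; lia.
  destruct (Z.eq_dec (y-1) (yh X)); [right|left]; lia.
- destruct (near_gap_col n dx) as [n1 n2]; clear n.
  left; split; [tauto | simpl; destruct (Z.ltb_spec y (yl X)); lia].
Qed.

Lemma near_dist X Y : near X Y ->
  [/\ xl Y - xh X <= 2, xl X - xh Y <= 2, yl Y - yh X <= 2 & yl X - yh Y <= 2].
Proof. unfold near, gap; intros n; split; lia. Qed.

Lemma fill_dom_bridge X Y x y : valid X -> valid Y -> near X Y -> fill_dom X Y x y ->
  ~ inside Y x y -> xl Y <= x <= xh Y ->
  (inside X x (y-1) /\ inside Y x (y+1)) \/ (inside Y x (y-1) /\ inside X x (y+1)).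
Proof.
intros [_ vy] [_ vy'] n [dx dy] e e'; destruct (near_dist n) as [_ _ n1 n2]; clear n.
assert (xl X <= x <= xh X) by lia; clear dx; unfold inside in *.
destruct dy as [dy|[dy|dy]]; [tauto|left|right]; lia.
Qed.

Lemma fill_dom_bridge' X Y x y : valid X -> valid Y -> near X Y -> fill_dom X Y x y ->
  ~ inside X x y -> yl X <= y <= yh X ->
  (inside X (x-1) y /\ inside Y (x+1) y) \/ (inside Y (x-1) y /\ inside X (x+1) y).
Proof.
intros [vx _] [vx' _] n [dx dy] e e'; destruct (near_dist n) as [n1 n2 _ _]; clear n.
assert (yl Y <= y <= yh Y) by lia; clear dy; unfold inside in *.
destruct dx as [dx|[dx|dx]]; [tauto|left|right]; lia.
Qed.

Lemma merge_cell P X Y : valid X -> valid Y -> near X Y ->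
  (forall x y, inside X x y -> P x y) -> (forall x y, inside Y x y -> P x y) ->
  forall x y, fill_dom X Y x y -> plane_infected P (fill_dist X Y x y + 1) x y.
Proof.
intros vX vY nXY HX HY x y D.
assert (g0 : forall a b c d, 0 <= gap a b c d) by (unfold gap; lia).
assert (main : forall k : nat, forall x y, fill_dom X Y x y \/ inside X x y \/ inside Y x y ->
  fill_dist X Y x y <= Z.of_nat k -> plane_infected P (Z.of_nat k + 1) x y).
2:{ assert (d0 : 0 <= fill_dist X Y x y) by (apply Z.add_nonneg_nonneg; apply g0).
    replace (fill_dist X Y x y) with (Z.of_nat (Z.to_nat (fill_dist X Y x y))) by lia.
    apply main; [tauto | lia]. }
clear x y D; intros k; induction k as [|k IH]; intros x y D H.
all: destruct (classic (inside X x y)) as [i|nX]; [apply infected_init; auto|].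
all: destruct (classic (inside Y x y)) as [i|nY]; [apply infected_init; auto|].
all: destruct D as [D|[D|D]]; [|tauto|tauto].
all: assert (cX : forall u v, inside X u v -> plane_infected P 0 u v)
  by (intros; apply infected_init; auto).
all: assert (cY : forall u v, inside Y u v -> plane_infected P 0 u v)
  by (intros; apply infected_init; auto).
all: destruct (classic (xl Y <= x <= xh Y)) as [e|e];
  [apply (@infected_le _ (0+1)); [lia|]; apply infected_step; [lia|]; right; left;
   destruct (fill_dom_bridge vX vY nXY D nY e) as [[? ?]|[? ?]]; auto |].
all: destruct (classic (yl X <= y <= yh X)) as [e'|e'];
  [apply (@infected_le _ (0+1)); [lia|]; apply infected_step; [lia|]; left;
   destruct (fill_dom_bridge' vX vY nXY D nX e') as [[? ?]|[? ?]]; auto |].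
all: destruct (gap_toward e (proj1 vY)) as [gx gx1].
all: destruct (gap_toward e' (proj2 vX)) as [gy gy1].
  exfalso; unfold fill_dist in H; lia.
replace (Z.of_nat k.+1 + 1) with (Z.of_nat k + 1 + 1) by lia.
apply infected_step; [lia|]; unfold two_nbrs.
assert (hx : plane_infected P (Z.of_nat k + 1) (if Z.ltb x (xl Y) then x+1 else x-1) y).
{ apply IH; [|unfold fill_dist in *; lia].
  destruct (fill_dom_toward vX vY nXY D e); tauto. }
assert (hy : plane_infected P (Z.of_nat k + 1) x (if Z.ltb y (yl X) then y+1 else y-1)).
{ apply IH; [|unfold fill_dist in *; lia].
  destruct (fill_dom_toward' vX vY nXY D e'); tauto. }
destruct (Z.ltb x (xl Y)), (Z.ltb y (yl X)); tauto.
Qed.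

Lemma interval_cover l h l' h' x : Z.min l l' <= x <= Z.max h h' ->
  l <= x <= h \/ l' <= x <= h' \/ h < x < l' \/ h' < x < l.
Proof. lia. Qed.

Lemma hull_cover X Y x y : inside (hull X Y) x y ->
  inside X x y \/ inside Y x y \/ fill_dom X Y x y \/ fill_dom Y X x y.
Proof.
intros [hx hy]; simpl in hx, hy.
apply interval_cover in hx; apply interval_cover in hy.
unfold inside, fill_dom; tauto.
Qed.

Lemma near_sym X Y : near X Y -> near Y X.
Proof. rlia. Qed.

Lemma merge P X Y c : valid X -> valid Y -> near X Y ->
  (forall x y, inside X x y -> P x y) -> (forall x y, inside Y x y -> P x y) ->
  (forall x y, inside (hull X Y) x y -> ~ inside X x y -> ~ inside Y x y ->
     (fill_dom X Y x y -> fill_dist X Y x y + 1 <= c) /\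
     (fill_dom Y X x y -> fill_dist Y X x y + 1 <= c)) ->
  forall x y, inside (hull X Y) x y -> plane_infected P c x y.
Proof.
intros vX vY nXY HX HY Hc x y H.
destruct (classic (inside X x y)) as [i|i]; [apply infected_init; auto|].
destruct (classic (inside Y x y)) as [j|j]; [apply infected_init; auto|].
destruct (Hc x y H i j) as [c1 c2].
destruct (hull_cover H) as [?|[?|[D|D]]]; try tauto.
- apply (@infected_le _ _ _ _ _ (c1 D)); apply merge_cell; auto.
- apply (@infected_le _ _ _ _ _ (c2 D)); apply merge_cell; auto; apply near_sym; auto.
Qed.

Definition if_else0 (b : bool) (z : Z) := if b then z else 0.

(* Bounds the time in which [X] and one more rectangle near it fill their hull
   [R]; only the enlargement of [X] enters. *)
Definition merge_time X R :=
  Z.max (if_else0 (height X <? height R) (width R)) (if_else0 (width X <? width R) (height R))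
  + (width R - width X) + (height R - height X) + 2.

Lemma gap_le l h l' h' x : l <= h -> l' <= h' ->
  Z.min l l' <= x <= Z.max h h' ->
  gap x x l h <= Z.max h h' - Z.min l l' - (h - l).
Proof. unfold gap; lia. Qed.

Lemma fill_dist_row X Y x y : valid X -> valid Y -> near X Y -> fill_dom X Y x y ->
  ~ inside X x y -> yl X <= y <= yh X -> fill_dist X Y x y <= 1.
Proof.
intros vX vY n D nX e; destruct (fill_dom_bridge' vX vY n D nX e) as [[[? _] [? _]]|[[? _] [? _]]];
clear n D nX; unfold fill_dist, gap; lia.
Qed.

Lemma fill_dist_col X Y x y : valid X -> valid Y -> near X Y -> fill_dom X Y x y ->
  ~ inside Y x y -> xl Y <= x <= xh Y -> fill_dist X Y x y <= 1.
Proof.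
intros vX vY n D nX e; destruct (fill_dom_bridge vX vY n D nX e) as [[[_ ?] [_ ?]]|[[_ ?] [_ ?]]];
clear n D nX; unfold fill_dist, gap; lia.
Qed.

Lemma merge_time_ge X Y (R := hull X Y) : valid X -> valid Y ->
  [/\ 2 <= merge_time X R,
      height X < height R -> width R + (height R - height X) + 2 <= merge_time X R &
      width X < width R -> height R + (width R - width X) + 2 <= merge_time X R].
Proof.
intros [vx vy] [vx' vy']; unfold merge_time, if_else0.
assert (0 <= height R - height X /\ 0 <= width R - width X /\ 0 <= width R /\ 0 <= height R).
  unfold R, width, height; simpl; lia.
destruct (Z.ltb_spec (height X) (height R)), (Z.ltb_spec (width X) (width R)); split; lia.
Qed.

Lemma merge_merge_time P X Y : valid X -> valid Y -> near X Y ->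
  (forall x y, inside X x y -> P x y) -> (forall x y, inside Y x y -> P x y) ->
  forall x y, inside (hull X Y) x y -> plane_infected P (merge_time X (hull X Y)) x y.
Proof.
intros vX vY nXY HX HY; apply merge; auto.
intros x y [hx hy] nX nY; simpl in hx, hy.
destruct (merge_time_ge vX vY) as [c2 ch cw].
destruct vX as [vx vy], vY as [vx' vy'].
assert (gyX := gap_le vy vy' hy); assert (gxX := gap_le vx vx' hx).
split; intros D.
- destruct (classic (yl X <= y <= yh X)) as [e|e].
    assert (H := @fill_dist_row X Y x y (conj vx vy) (conj vx' vy') nXY D nX e); lia.
  assert (height X < height (hull X Y)) by (clear -e hy vy vy'; rlia).
  assert (gap x x (xl Y) (xh Y) <= width (hull X Y) - 1).
    clear -hx vx vx'; unfold gap; rlia.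
  apply Z.le_trans with (2 := ch H); clear -H0 gyX; unfold fill_dist, height in *; simpl in *; lia.
- destruct (classic (xl X <= x <= xh X)) as [e|e].
    assert (H := @fill_dist_col Y X x y (conj vx' vy') (conj vx vy) (near_sym nXY) D nX e); lia.
  assert (width X < width (hull X Y)) by (clear -e hx vx vx'; rlia).
  assert (gap y y (yl Y) (yh Y) <= height (hull X Y) - 1).
    clear -hy vy vy'; unfold gap; rlia.
  apply Z.le_trans with (2 := cw H); clear -H0 gxX; unfold fill_dist, width in *; simpl in *; lia.
Qed.

Lemma merge_codim P X Y : valid X -> valid Y -> near X Y ->
  (forall x y, inside X x y -> P x y) -> (forall x y, inside Y x y -> P x y) ->
  width (hull X Y) + height (hull X Y) <= width X + height X + 1 ->
  width (hull X Y) + height (hull X Y) <= width Y + height Y + 1 ->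
  forall x y, inside (hull X Y) x y -> plane_infected P 3 x y.
Proof.
intros vX vY nXY HX HY cX cY; apply merge; auto.
intros x y [hx hy] nX nY; simpl in hx, hy.
destruct vX as [vx vy], vY as [vx' vy'].
assert (gyX := gap_le vy vy' hy); assert (gxX := gap_le vx vx' hx).
rewrite Z.max_comm Z.min_comm in hx; rewrite Z.max_comm Z.min_comm in hy.
assert (gyY := gap_le vy' vy hy); assert (gxY := gap_le vx' vx hx).
clear -gyX gxX gyY gxY cX cY vx vx' vy vy'.
rewrite (Z.max_comm (xh Y)) (Z.min_comm (xl Y)) in gxY.
rewrite (Z.max_comm (yh Y)) (Z.min_comm (yl Y)) in gyY.
assert (0 <= Z.max (xh X) (xh Y) - Z.min (xl X) (xl Y) - (xh X - xl X)) by lia.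
assert (0 <= Z.max (yh X) (yh Y) - Z.min (yl X) (yl Y) - (yh X - yl X)) by lia.
assert (0 <= Z.max (xh X) (xh Y) - Z.min (xl X) (xl Y) - (xh Y - xl Y)) by lia.
assert (0 <= Z.max (yh X) (yh Y) - Z.min (yl X) (yl Y) - (yh Y - yl Y)) by lia.
unfold fill_dist, width, height in *; simpl in *; lia.
Qed.

Lemma hull_sym X Y : hull X Y = hull Y X.
Proof. apply rect_eq; rlia. Qed.

(** * Internally spanned rectangles *)

Definition restrict A R x y := A x y /\ inside R x y.
Definition spans A R t := forall x y, inside R x y -> plane_infected (restrict A R) t x y.
Definition spanned A R := valid R /\ exists t, spans A R t.

Lemma spans_le A R t t' : t <= t' -> spans A R t -> spans A R t'.
Proof. intros H S x y i; apply (infected_le H); auto. Qed.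

Lemma subrect_inside X Y x y : subrect X Y -> inside X x y -> inside Y x y.
Proof. intros [? ? ? ?]; rlia. Qed.

Lemma restrict_subrect A X R x y : subrect X R -> restrict A X x y -> restrict A R x y.
Proof. intros s [? ?]; split; auto; eapply subrect_inside; eauto. Qed.

Lemma subrect_hull X Y : subrect X (hull X Y).
Proof. split; rlia. Qed.

Lemma valid_hull X Y : valid X -> valid Y -> valid (hull X Y).
Proof. rlia. Qed.

Lemma spans_merge A X Y t c : valid X -> valid Y -> near X Y -> 0 <= t -> 0 <= c ->
  (forall P, (forall x y, inside X x y -> P x y) -> (forall x y, inside Y x y -> P x y) ->
    forall x y, inside (hull X Y) x y -> plane_infected P c x y) ->
  spans A X t -> spans A Y t -> spans A (hull X Y) (t + c).
Proof.
intros vX vY nXY t0 c0 M SX SY x y H; apply infected_comp; auto; apply M; auto.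
- intros u v i; eapply infected_sub; [|apply SX; exact i].
  intros a b; apply restrict_subrect, subrect_hull.
- intros u v i; eapply infected_sub; [|apply SY; exact i].
  intros a b; apply restrict_subrect; rewrite hull_sym; apply subrect_hull.
Qed.

Lemma merge_time_ge0 X R : valid R -> subrect X R -> 0 <= merge_time X R.
Proof.
intros v [? ? ? ?]; unfold merge_time, if_else0.
destruct (height X <? height R), (width X <? width R); rlia.
Qed.

Lemma spanned_hull A X Y : spanned A X -> spanned A Y -> near X Y ->
  spanned A (hull X Y).
Proof.
intros [vX [t HX]] [vY [s HY]] n; split; [apply valid_hull; auto|].
exists (Z.max 0 (Z.max t s) + merge_time X (hull X Y)).
apply spans_merge; auto; try lia.
- apply merge_time_ge0; [apply valid_hull; auto | apply subrect_hull].
- intros; apply merge_merge_time; auto.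
- apply (@spans_le _ _ t); auto; lia.
- apply (@spans_le _ _ s); auto; lia.
Qed.

Lemma cell_spans A x y : A x y -> spans A (cell x y) 0.
Proof.
intros H u v i; apply infected_init; split; auto.
assert (u = x /\ v = y) as [-> ->] by rlia; auto.
Qed.

Lemma cell_spanned A x y : A x y -> spanned A (cell x y).
Proof. intros H; split; [rlia | exists 0; apply cell_spans; auto]. Qed.

Lemma spanned_cell A R : spanned A R -> width R = 1 -> height R = 1 -> spans A R 0.
Proof.
intros [v [t H]] w h x y i; apply infected_init; split; auto.
apply NNPP; intros nA.
cut (False); auto; apply (@infected_invariant (restrict A R) (fun _ _ => False)) with t x y; auto.
- intros a b [Ha Hb]; apply nA; replace x with a by rlia; replace y with b by rlia; auto.
- unfold two_nbrs; tauto.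
Qed.

Lemma gap_points l h l' h' u u' : l <= u <= h -> l' <= u' <= h' ->
  gap l h l' h' <= Z.abs (u - u').
Proof. unfold gap; lia. Qed.

Lemma near_points X Y u v u' v' : inside X u v -> inside Y u' v' ->
  Z.abs (u - u') + Z.abs (v - v') <= 2 -> near X Y.
Proof.
intros [a b] [a' b'] H.
assert (H1 := gap_points a a'); assert (H2 := gap_points b b'); unfold near; lia.
Qed.

Lemma inside_hull X Y u v u' v' x y : inside X u v -> inside Y u' v' ->
  Z.min u u' <= x <= Z.max u u' -> Z.min v v' <= y <= Z.max v v' -> inside (hull X Y) x y.
Proof. intros [a b] [a' b'] ? ?; split; simpl; lia. Qed.

Definition covered (F : rect -> Prop) x y := exists2 X, F X & inside X x y.

Lemma covered_closed (F : rect -> Prop) :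
  (forall X Y, F X -> F Y -> near X Y -> F (hull X Y)) ->
  forall x y, two_nbrs (covered F) x y -> covered F x y.
Proof.
intros HF x y H.
assert (exists X Y, [/\ F X, F Y, near X Y & inside (hull X Y) x y]) as [X [Y [FX FY n i]]].
2: exists (hull X Y); auto.
destruct H as [H|[H|[H|[H|[H|H]]]]];
destruct H as [[X FX iX] [Y FY iY]]; exists X, Y;
(split; auto; [eapply near_points; eauto; lia | eapply inside_hull; eauto; lia]).
Qed.

Definition semiperimeter R := width R + height R.

Lemma maximal_rect (F : rect -> Prop) R X0 :
  F X0 -> (forall X, F X -> subrect X R) ->
  exists2 Y, F Y & forall X, F X -> semiperimeter X <= semiperimeter Y.
Proof.
intros F0 HR.
assert (main : forall k : nat, forall X, F X -> semiperimeter R - semiperimeter X <= Z.of_nat k ->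
  exists2 Y, F Y & forall X, F X -> semiperimeter X <= semiperimeter Y).
2: apply (@main (Z.to_nat (semiperimeter R - semiperimeter X0)) X0); auto; lia.
intros k; induction k as [|k IH]; intros X FX Hk.
  exists X; auto; intros Y FY; destruct (HR Y FY); unfold semiperimeter in *; rlia.
destruct (classic (exists2 Y, F Y & semiperimeter X < semiperimeter Y)) as [[Y FY l]|n].
  apply (IH Y); auto; lia.
exists X; auto; intros Y FY; apply Z.nlt_ge; intros l; apply n; exists Y; auto.
Qed.

(* If no two proper spanned subrectangles merged into [R], those near each
   other would merge to proper ones; they would cover [R], and a largest one
   could be enlarged. *)
Lemma decompose A R : spanned A R -> 2 < semiperimeter R ->
  exists X Y, [/\ spanned A X, spanned A Y, near X Y & hull X Y = R] /\ (X <> R /\ Y <> R).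
Proof.
intros [vR [t SR]] big; apply NNPP; intros no.
set (F X := [/\ spanned A X, subrect X R & X <> R]).
assert (HF : forall X Y, F X -> F Y -> near X Y -> F (hull X Y)).
{ intros X Y [a b c] [a' b' c'] n; split.
  - apply spanned_hull; auto.
  - destruct b, b'; split; rlia.
  - intros e; apply no; exists X, Y; split; split; auto. }
assert (cov : forall x y, inside R x y -> covered F x y).
{ intros x y i; generalize (SR x y i).
  apply infected_invariant; [|apply covered_closed; auto].
  intros u v [Au iu]; exists (cell u v); [|rlia].
  split; [apply cell_spanned; auto | split; rlia |].
  intros e; rewrite -e in big; unfold semiperimeter in big; rlia. }
destruct (cov (xl R) (yl R)) as [X0 F0 _]; [rlia|].
destruct (@maximal_rect F R X0 F0) as [Y FY mY]; [intros X []; auto|].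
assert (exists x y, [/\ inside R x y, ~ inside Y x y & near Y (cell x y)]) as [x [y [i o n]]].
{ destruct FY as [[vY _] [s1 s2 s3 s4] ne].
  destruct (Z.eq_dec (xl Y) (xl R)) as [e1|]; [|exists (xl Y - 1), (yl Y); split; rlia].
  destruct (Z.eq_dec (xh Y) (xh R)) as [e2|]; [|exists (xh Y + 1), (yl Y); split; rlia].
  destruct (Z.eq_dec (yl Y) (yl R)) as [e3|]; [|exists (xl Y), (yl Y - 1); split; rlia].
  destruct (Z.eq_dec (yh Y) (yh R)) as [e4|]; [|exists (xl Y), (yh Y + 1); split; rlia].
  exfalso; apply ne, rect_eq; auto. }
destruct (cov x y i) as [W FW iW].
assert (semiperimeter (hull Y W) <= semiperimeter Y).
{ apply mY, HF; auto; destruct FY as [[vY _] _ _]; destruct FW as [[vW _] _ _]; rlia. }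
destruct FY as [[vY _] _ _]; destruct FW as [[vW _] _ _]; unfold semiperimeter in *; rlia.
Qed.

End Plane.

Section Potential.
Local Open Scope Z_scope.
Implicit Types a b : Z.

Definition phi a b : Z :=
  if b <=? a then
    if 3 * b <=? a then 18 * a * b - 9 * b * b else 12 * a * b + a * a
  else if 3 * a <=? b then 18 * a * b - 9 * a * a else 12 * a * b + b * b.

Ltac phi_cases := unfold phi;
  repeat match goal with |- context [?u <=? ?v] => destruct (Z.leb_spec u v); try lia end.

Lemma phi_sym a b : phi a b = phi b a.
Proof. phi_cases; nia. Qed.

Lemma phi_ge0 a b : 0 <= a -> 0 <= b -> 0 <= phi a b.
Proof. intros; phi_cases; nia. Qed.

Lemma phi_S a b : 0 <= a -> 0 <= b -> phi a b <= phi (a + 1) b.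
Proof. intros; phi_cases; nia. Qed.

Lemma phi_step20 a b : 2 <= a -> 0 <= b -> phi (a-2) b + 18 * b - 36 <= phi a b.
Proof. intros; phi_cases; nia. Qed.

Lemma phi_step11 a b : 1 <= a -> 1 <= b ->
  phi (a-1) (b-1) + 18 * Z.max a b - 36 <= phi a b.
Proof. intros; phi_cases; nia. Qed.

Lemma phi_step30 a b : 3 <= a -> 0 <= b -> phi (a-3) b + 36 * b - 36 <= phi a b.
Proof. intros; phi_cases; nia. Qed.

Lemma phi_step21 a b : 2 <= a -> 1 <= b -> phi (a-2) (b-1) + 18 * (a + b) - 54 <= phi a b.
Proof. intros; phi_cases; nia. Qed.

Lemma phi_mono a b a' b' : 0 <= a <= a' -> 0 <= b <= b' -> phi a b <= phi a' b'.
Proof.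
assert (mono1 : forall c a a', 0 <= c -> 0 <= a <= a' -> phi a c <= phi a' c).
{ clear a b a' b'; intros c a a' Hc [Ha Haa']; revert a' Haa'.
  apply Zlt_lower_bound_ind; intros a' IH l.
  destruct (Z.eq_dec a a') as [->|n]; [lia|].
  apply Z.le_trans with (phi (a' - 1) c); [apply IH; lia|].
  replace a' with (a' - 1 + 1) at 2 by lia; apply phi_S; lia. }
intros Ha Hb; apply Z.le_trans with (phi a' b); [apply mono1; lia|].
rewrite (phi_sym a') (phi_sym a'); apply mono1; lia.
Qed.

Definition merge_time_dims a' b' a b :=
  Z.max (if_else0 (b' <? b) a) (if_else0 (a' <? a) b) + (a - a') + (b - b') + 2.

Definition bound a b := phi a b + 180 * (a + b).

Lemma merge_timeE X R : merge_time X R = merge_time_dims (width X) (height X) (width R) (height R).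
Proof. reflexivity. Qed.

Lemma bound_sym a b : bound a b = bound b a.
Proof. unfold bound; rewrite phi_sym; lia. Qed.

Lemma merge_time_dims_sym a' b' a b : merge_time_dims a' b' a b = merge_time_dims b' a' b a.
Proof. unfold merge_time_dims; lia. Qed.

Ltac merge_time_cases := unfold merge_time_dims, if_else0;
  repeat match goal with |- context [?u <? ?v] => destruct (Z.ltb_spec u v); try lia end.

Lemma price_codim2 a' b' a b : 1 <= a' <= a -> 1 <= b' <= b -> a' + b' + 2 <= a + b ->
  bound a' b' + 18 * merge_time_dims a' b' a b <= bound a b.
Proof.
wlog : a' b' a b / b - b' <= a - a'.
  intros main Ha Hb H; destruct (Z.le_gt_cases (b - b') (a - a')); [apply main; lia|].
  rewrite bound_sym merge_time_dims_sym (bound_sym a); apply main; lia.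
intros l Ha Hb H; unfold bound.
destruct (Z.eq_dec b' b) as [->|ne].
- assert (phi a' b <= phi (a - 2) b) by (apply phi_mono; lia).
  assert (H1 := @phi_step20 a b); merge_time_cases.
- assert (phi a' b' <= phi (a - 1) (b - 1)) by (apply phi_mono; lia).
  assert (H1 := @phi_step11 a b); merge_time_cases.
Qed.

(* The last row costs [a], more than its price in [phi]; the surplus of the
   preceding merge pays for it, unless that merge enlarged both sides by 1. *)
Lemma price_row a' b' a b : 1 <= a' <= a -> 1 <= b' <= b - 1 -> a' + b' + 3 <= a + b ->
  ~ (a' + 1 = a /\ b' + 2 = b) ->
  bound a' b' + 18 * (merge_time_dims a' b' a (b-1) + (a + 3)) <= bound a b.
Proof.
intros Ha Hb H no; unfold bound.
destruct (Z.eq_dec a' a) as [->|na].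
- assert (phi a b' <= phi a (b - 3)) by (apply phi_mono; lia).
  assert (H1 := @phi_step30 b a); rewrite (phi_sym (b-3)) (phi_sym b) in H1; merge_time_cases.
- destruct (Z.eq_dec (b'+1) b) as [e|ne].
    assert (phi a' b' <= phi (a-2) (b - 1)) by (apply phi_mono; lia).
    assert (H1 := @phi_step21 a b); merge_time_cases.
  assert (H1 := @phi_step11 a b).
  destruct (Z.eq_dec (a'+1) a) as [e|ne'].
    assert (phi a' b' <= phi (a-1) (b - 3)) by (apply phi_mono; lia).
    assert (H2 := @phi_step20 (b-1) (a-1)).
    replace (b - 1 - 2) with (b - 3) in H2 by lia.
    rewrite (phi_sym (b-3)) (phi_sym (b-1)) in H2; merge_time_cases.
  assert (phi a' b' <= phi (a-2) (b - 2)) by (apply phi_mono; lia).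
  assert (H2 := @phi_step11 (a-1) (b-1)).
  replace (b - 1 - 1) with (b - 2) in H2 by lia.
  replace (a - 1 - 1) with (a - 2) in H2 by lia.
  merge_time_cases.
Qed.

Lemma price_col a' b' a b : 1 <= a' <= a - 1 -> 1 <= b' <= b -> a' + b' + 3 <= a + b ->
  ~ (a' + 2 = a /\ b' + 1 = b) ->
  bound a' b' + 18 * (merge_time_dims a' b' (a-1) b + (b + 3)) <= bound a b.
Proof.
intros; rewrite bound_sym merge_time_dims_sym (bound_sym a); apply price_row; lia.
Qed.

End Potential.

Section Planar.
Local Open Scope Z_scope.
Implicit Types (A : Z -> Z -> Prop) (x y t : Z) (R Q X Y : rect).

Definition rect_bound R := bound (width R) (height R).
Definition timely A R := exists t, [/\ 0 <= t, spans A R t & 18 * t <= rect_bound R].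

Lemma valid_dims R : valid R -> 1 <= width R /\ 1 <= height R.
Proof. unfold valid, width, height; lia. Qed.

Lemma subrect_dims X R : subrect X R -> width X <= width R /\ height X <= height R.
Proof. intros [? ? ? ?]; unfold width, height; lia. Qed.

Lemma subrect_semiperimeter X R : subrect X R -> X <> R -> semiperimeter X + 1 <= semiperimeter R.
Proof.
intros [s1 s2 s3 s4] n; unfold semiperimeter, width, height.
destruct (Z.eq_dec (xl X) (xl R)) as [e1|]; [|lia].
destruct (Z.eq_dec (xh X) (xh R)) as [e2|]; [|lia].
destruct (Z.eq_dec (yl X) (yl R)) as [e3|]; [|lia].
destruct (Z.eq_dec (yh X) (yh R)) as [e4|]; [|lia].
exfalso; apply n, rect_eq; auto.
Qed.

Lemma spans_merge_merge_time A X Y t : valid X -> valid Y -> near X Y -> 0 <= t ->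
  spans A X t -> spans A Y t -> spans A (hull X Y) (t + merge_time X (hull X Y)).
Proof.
intros vX vY n t0 SX SY; apply spans_merge; auto.
- apply merge_time_ge0; [apply valid_hull; auto | apply subrect_hull].
- intros; apply merge_merge_time; auto.
Qed.

Lemma spans_merge_lagging A X Y t t' : valid X -> valid Y -> near X Y -> 0 <= t -> t' <= t ->
  spans A X t -> spans A Y t' -> spans A (hull X Y) (t + merge_time X (hull X Y)).
Proof. intros; apply spans_merge_merge_time; auto; apply (spans_le (t := t')); auto. Qed.

Lemma price_merge X R : valid X -> subrect X R -> semiperimeter X + 2 <= semiperimeter R ->
  rect_bound X + 18 * merge_time X R <= rect_bound R.
Proof.
intros v s H; destruct (valid_dims v), (subrect_dims s); rewrite merge_timeE.
apply price_codim2; unfold semiperimeter in H; lia.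
Qed.

Lemma rect_bound_ge0 R : valid R -> 0 <= rect_bound R.
Proof.
intros v; destruct (valid_dims v); unfold rect_bound, bound.
assert (H1 := @phi_ge0 (width R) (height R)); lia.
Qed.

Lemma timely_merge A X Y R : valid X -> valid Y -> near X Y -> hull X Y = R ->
  timely A X -> timely A Y -> semiperimeter X + 2 <= semiperimeter R ->
  semiperimeter Y + 2 <= semiperimeter R -> timely A R.
Proof.
intros vX vY n <- [t [t0 Ht bt]] [s [s0 Hs bs]] cX cY.
assert (sX := subrect_hull X Y); assert (sY := subrect_hull Y X); rewrite hull_sym in sY.
assert (pX := price_merge vX sX cX); assert (pY := price_merge vY sY cY).
assert (vH := valid_hull vX vY).
assert (cX0 := merge_time_ge0 vH sX); assert (cY0 := merge_time_ge0 vH sY).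
destruct (Z.le_gt_cases s t).
- exists (t + merge_time X (hull X Y)); split; [lia| |lia].
  apply (spans_merge_lagging (t' := s)); auto.
- exists (s + merge_time Y (hull X Y)); split; [lia| |lia].
  rewrite hull_sym; apply (spans_merge_lagging (t' := t)); auto; [apply near_sym; auto|lia].
Qed.

Lemma timely_codim1 A X Y R : valid X -> valid Y -> near X Y -> hull X Y = R ->
  timely A X -> timely A Y -> semiperimeter X + 1 = semiperimeter R ->
  semiperimeter Y + 1 = semiperimeter R -> timely A R.
Proof.
intros vX vY n <- [t [t0 Ht bt]] [s [s0 Hs bs]] cX cY.
assert (sX := subrect_hull X Y); assert (sY := subrect_hull Y X); rewrite hull_sym in sY.
exists (Z.max t s + 3); split; [lia| |].
- apply spans_merge; auto; try lia.
  + intros; apply (@merge_codim _ X Y); auto; unfold semiperimeter in *; lia.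
  + apply (spans_le (t := t)); auto; lia.
  + apply (spans_le (t := s)); auto; lia.
- destruct (valid_dims vX), (subrect_dims sX), (valid_dims vY), (subrect_dims sY).
  assert (phi (width X) (height X) <= phi (width (hull X Y)) (height (hull X Y)))
    by (apply phi_mono; lia).
  assert (phi (width Y) (height Y) <= phi (width (hull X Y)) (height (hull X Y)))
    by (apply phi_mono; lia).
  unfold rect_bound, bound, semiperimeter in *; lia.
Qed.

Lemma timely_cell A X x y R : valid X -> near X (cell x y) -> hull X (cell x y) = R ->
  A x y -> timely A X -> semiperimeter X + 2 <= semiperimeter R -> timely A R.
Proof.
intros vX n <- Axy [t [t0 Ht bt]] cX.
assert (vc : valid (cell x y)) by (split; simpl; lia).
assert (sX := subrect_hull X (cell x y)).
assert (vH := valid_hull vX vc).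
assert (pX := price_merge vX sX cX); assert (cX0 := merge_time_ge0 vH sX).
exists (t + merge_time X (hull X (cell x y))); split; [lia| |lia].
apply (spans_merge_lagging (t' := 0)); auto; apply cell_spans; auto.
Qed.

Lemma gap_hull l h l' h' l'' h'' :
  gap l h (Z.min l' l'') (Z.max h' h'') <= gap l h l' h'.
Proof. unfold gap; lia. Qed.

Lemma near_hull X Y W : near X Y -> near X (hull Y W).
Proof.
unfold near; simpl; intros H.
assert (H1 := @gap_hull (xl X) (xh X) (xl Y) (xh Y) (xl W) (xh W)).
assert (H2 := @gap_hull (yl X) (yh X) (yl Y) (yh Y) (yl W) (yh W)); lia.
Qed.

Lemma gap_missing l h l' h' x : l <= h -> l' <= h' ->
  Z.min l l' <= x <= Z.max h h' ->
  let d := Z.max h h' - Z.min l l' - (h - l) in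
  gap l h x x <= d /\ (d = 1 -> gap l h x x = 1 -> gap l' h' x x = 0).
Proof. unfold gap; simpl; split; lia. Qed.

Lemma gap_beyond l h l' h' x : l <= h -> l' <= h' ->
  x = Z.max h h' + 1 \/ x = Z.min l l' - 1 ->
  let d := Z.max h h' - Z.min l l' - (h - l) in
  [/\ gap l h x x <= d + 1 , 0 <= d & gap l h x x = 1 \/ gap l' h' x x = 1].
Proof. unfold gap; simpl; intros ? ? [-> | ->]; split; lia. Qed.

Lemma far_gain Q R X Y x y : valid X -> valid Y -> hull X Y = Q -> subrect Q R ->
  semiperimeter Q + 1 = semiperimeter R -> inside R x y -> ~ inside Q x y ->
  ~ near X (cell x y) -> ~ near Y (cell x y) ->
  semiperimeter X + 2 <= semiperimeter Q /\ ~ (width X + 1 = width Q /\ height X + 1 = height Q).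
Proof.
intros [vx vy] [vx' vy'] <- [s1 s2 s3 s4] c [i1 i2] o fX fY.
assert (xl (hull X Y) <= x <= xh (hull X Y) /\ (y = yh (hull X Y) + 1 \/ y = yl (hull X Y) - 1) \/
        yl (hull X Y) <= y <= yh (hull X Y) /\ (x = xh (hull X Y) + 1 \/ x = xl (hull X Y) - 1))
  as [[ia e]|[ia e]].
  clear -s1 s2 s3 s4 c i1 i2 o; unfold semiperimeter, width, height, inside in *; lia.
all: clear o c s1 s2 s3 s4 i1 i2; unfold near, semiperimeter, width, height in *; simpl in *.
- destruct (gap_missing vx vx' ia) as [g1 g2]; clear ia.
  destruct (gap_beyond vy vy' e) as [g3 g4 g5]; clear e; split; lia.
- destruct (gap_missing vy vy' ia) as [g1 g2]; clear ia.
  destruct (gap_beyond vx vx' e) as [g3 g4 g5]; clear e; split; lia.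
Qed.

Lemma codim1_merge_time Q R : valid R -> subrect Q R -> semiperimeter Q + 1 = semiperimeter R ->
  (height R = height Q + 1 /\ width R = width Q /\ merge_time Q R = width R + 3) \/
  (width R = width Q + 1 /\ height R = height Q /\ merge_time Q R = height R + 3).
Proof.
intros v s c; destruct (subrect_dims s) as [d1 d2], (valid_dims v) as [v1 v2].
unfold semiperimeter in c.
unfold merge_time, if_else0.
destruct (Z.eq_dec (height R) (height Q + 1)) as [e|e]; [left|right];
destruct (Z.ltb_spec (height Q) (height R)), (Z.ltb_spec (width Q) (width R)); lia.
Qed.

Lemma outside_cell A Q R : spanned A R -> subrect Q R -> Q <> R ->
  exists x y, [/\ A x y, inside R x y & ~ inside Q x y].
Proof.
intros [vR [t HR]] s n; apply NNPP; intros no.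
assert (inc : forall x y, inside R x y -> inside Q x y).
{ intros x y i; generalize (HR x y i); apply infected_invariant; [|apply rect_closed].
  intros u v [Au iu]; apply NNPP; intros o; apply no; exists u, v; split; auto. }
apply n; destruct s; destruct (inc (xl R) (yl R)); [destruct vR; split; lia|].
destruct (inc (xh R) (yh R)); [destruct vR; split; lia|].
apply rect_eq; lia.
Qed.

Lemma hull_outside Q R x y : valid Q -> subrect Q R -> semiperimeter Q + 1 = semiperimeter R ->
  inside R x y -> ~ inside Q x y -> hull Q (cell x y) = R /\ near Q (cell x y).
Proof.
intros [v1 v2] [s1 s2 s3 s4] c [i1 i2] o.
unfold semiperimeter, width, height, inside, near, gap, cell, hull in *; simpl in *.
split; [apply rect_eq; simpl|]; lia.
Qed.

Lemma hullA X Y W : hull X (hull Y W) = hull (hull X Y) W.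
Proof. apply rect_eq; simpl; lia. Qed.

Lemma cell_semi R : valid R -> semiperimeter R <= 2 -> width R = 1 /\ height R = 1.
Proof. intros v; destruct (valid_dims v); unfold semiperimeter; lia. Qed.

Lemma timely_near_part A R Q X Y x y :
  (forall W, spanned A W -> semiperimeter W + 1 <= semiperimeter R -> timely A W) ->
  spanned A X -> spanned A Y -> near X Y -> hull X Y = Q -> Y <> Q -> X <> Q ->
  subrect Q R -> semiperimeter Q + 1 = semiperimeter R -> A x y -> inside R x y -> ~ inside Q x y ->
  near Y (cell x y) -> timely A R.
Proof.
intros IH SX SY n HQ nY nX sQ cQ Axy i o nc.
assert (vX := proj1 SX); assert (vY := proj1 SY).
assert (vQ : valid Q) by (rewrite -HQ; apply valid_hull; auto).
assert (sX : subrect X Q) by (rewrite -HQ; apply subrect_hull).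
assert (sY : subrect Y Q) by (rewrite -HQ hull_sym; apply subrect_hull).
assert (cX := subrect_semiperimeter sX nX); assert (cY := subrect_semiperimeter sY nY).
assert (SQ : spanned A Q) by (rewrite -HQ; apply spanned_hull; auto).
assert (vc : valid (cell x y)) by (split; simpl; lia).
destruct (hull_outside vQ sQ cQ i o) as [HR _].
set (Y' := hull Y (cell x y)).
assert (SY' : spanned A Y') by (apply spanned_hull; auto; apply cell_spanned; auto).
destruct (classic (Y' = R)) as [e|ne].
  refine (timely_cell vY nc e Axy _ _); [apply IH; auto|]; lia.
assert (sY' : subrect Y' R).
{ rewrite -HR -HQ; unfold Y'; split; simpl; lia. }
assert (cY' := subrect_semiperimeter sY' ne).
assert (TX : timely A X) by (apply IH; auto; lia).
assert (TQ : timely A Q) by (apply IH; auto; lia).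
assert (TY' : timely A Y') by (apply IH; auto).
destruct (Z.eq_dec (semiperimeter Y' + 1) (semiperimeter R)) as [e|ne'].
- refine (timely_codim1 vQ (proj1 SY') _ _ TQ TY' cQ e).
  + destruct vY; apply (@near_points Q Y' (xl Y) (yl Y) (xl Y) (yl Y));
      [|unfold Y'; split; simpl; lia|lia].
    apply (subrect_inside sY); split; lia.
  + rewrite -HR; unfold Y'; rewrite hullA; f_equal; rewrite -HQ; apply rect_eq; simpl; lia.
- refine (timely_merge vX (proj1 SY') _ _ TX TY' _ _); try lia.
  + apply near_hull; auto.
  + unfold Y'; rewrite hullA HQ; auto.
Qed.

Lemma price_far Q R X Y x y : valid X -> valid Y -> hull X Y = Q -> subrect Q R ->
  semiperimeter Q + 1 = semiperimeter R -> inside R x y -> ~ inside Q x y ->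
  ~ near X (cell x y) -> ~ near Y (cell x y) ->
  rect_bound X + 18 * (merge_time X Q + merge_time Q R) <= rect_bound R.
Proof.
intros vX vY HQ sQ cQ i o fX fY.
destruct (far_gain vX vY HQ sQ cQ i o fX fY) as [g1 g2].
assert (sX : subrect X Q) by (rewrite -HQ; apply subrect_hull).
assert (vR : valid R) by (destruct i; split; lia).
destruct (valid_dims vX), (subrect_dims sX), (subrect_dims sQ); unfold semiperimeter in *.
rewrite (merge_timeE X); unfold rect_bound.
destruct (codim1_merge_time vR sQ cQ) as [[e1 [e2 ->]]|[e1 [e2 ->]]].
- replace (height Q) with (height R - 1) by lia; replace (width Q) with (width R) by lia.
  apply price_row; lia.
- replace (width Q) with (width R - 1) by lia; replace (height Q) with (height R) by lia.
  apply price_col; lia.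
Qed.

Lemma timely_far A R Q X Y x y :
  timely A X -> timely A Y -> spanned A X -> spanned A Y -> near X Y -> hull X Y = Q ->
  subrect Q R -> semiperimeter Q + 1 = semiperimeter R -> A x y -> inside R x y -> ~ inside Q x y ->
  ~ near X (cell x y) -> ~ near Y (cell x y) -> timely A R.
Proof.
intros [t [t0 Ht bt]] [s [s0 Hs bs]] [vX _] [vY _] n HQ sQ cQ Axy i o fX fY.
assert (HQ' : hull Y X = Q) by (rewrite hull_sym; auto).
assert (pX := price_far vX vY HQ sQ cQ i o fX fY).
assert (pY := price_far vY vX HQ' sQ cQ i o fY fX).
assert (vQ : valid Q) by (rewrite -HQ; apply valid_hull; auto).
assert (vc : valid (cell x y)) by (split; simpl; lia).
destruct (hull_outside vQ sQ cQ i o) as [HR nR].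
assert (sX : subrect X Q) by (rewrite -HQ; apply subrect_hull).
assert (sY : subrect Y Q) by (rewrite -HQ hull_sym; apply subrect_hull).
assert (vR : valid R) by (rewrite -HR; apply valid_hull; auto).
assert (cX0 := merge_time_ge0 vQ sX); assert (cY0 := merge_time_ge0 vQ sY).
assert (cQ0 := merge_time_ge0 vR sQ).
assert (fin : forall u, 0 <= u -> spans A Q u -> spans A R (u + merge_time Q R)).
{ intros u u0 Su; rewrite -HR; apply (spans_merge_lagging (t' := 0)); auto.
  apply cell_spans; auto. }
destruct (Z.le_gt_cases s t).
- exists (t + merge_time X Q + merge_time Q R); split; [lia| |lia]; apply fin; [lia|].
  rewrite -HQ; apply (spans_merge_lagging (t' := s)); auto.
- exists (s + merge_time Y Q + merge_time Q R); split; [lia| |lia]; apply fin; [lia|].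
  rewrite -HQ'; apply (spans_merge_lagging (t' := t)); auto; [apply near_sym; auto|lia].
Qed.

Theorem spanned_timely A R : spanned A R -> timely A R.
Proof.
assert (main : forall k : nat, forall R, semiperimeter R <= Z.of_nat k -> spanned A R -> timely A R).
2: intros S; apply (main (Z.to_nat (semiperimeter R))); auto; lia.
clear R; intros k; induction k as [|k IHk]; intros R Hk SR.
  destruct (valid_dims (proj1 SR)); unfold semiperimeter in Hk; lia.
assert (IH : forall W, spanned A W -> semiperimeter W + 1 <= semiperimeter R -> timely A W).
  intros W SW c; apply IHk; auto; lia.
assert (vR := proj1 SR).
destruct (Z.le_gt_cases (semiperimeter R) 2) as [small|big].
{ destruct (cell_semi vR small); exists 0; split; [lia| |assert (H1 := rect_bound_ge0 vR); lia].
  apply spanned_cell; auto. }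
destruct (classic (exists Q, [/\ spanned A Q, subrect Q R & semiperimeter Q + 1 = semiperimeter R]))
  as [[Q [SQ sQ cQ]]|no].
2:{ destruct (decompose SR big) as [X [Y [[SX SY n HR] [nX nY]]]].
    assert (sX : subrect X R) by (rewrite -HR; apply subrect_hull).
    assert (sY : subrect Y R) by (rewrite -HR hull_sym; apply subrect_hull).
    assert (cX := subrect_semiperimeter sX nX); assert (cY := subrect_semiperimeter sY nY).
    apply (@timely_merge A X Y R); auto; [apply (proj1 SX)|apply (proj1 SY)| |].
    - destruct (Z.eq_dec (semiperimeter X + 1) (semiperimeter R)); [|lia].
      exfalso; apply no; exists X; split; auto.
    - destruct (Z.eq_dec (semiperimeter Y + 1) (semiperimeter R)); [|lia].
      exfalso; apply no; exists Y; split; auto. }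
assert (vQ := proj1 SQ).
assert (nQ : Q <> R) by (intros e; subst; lia).
destruct (outside_cell SR sQ nQ) as [x [y [Axy i o]]].
destruct (hull_outside vQ sQ cQ i o) as [HR nR].
destruct (Z.le_gt_cases (semiperimeter Q) 2) as [small|bigQ].
{ destruct (cell_semi vQ small) as [w1 h1].
  assert (cQ0 := merge_time_ge0 vR sQ).
  exists (0 + merge_time Q R); split; [lia| |].
  - rewrite -HR; apply (spans_merge_lagging (t' := 0)); auto; try lia;
      [split; simpl; lia | apply spanned_cell; auto | apply cell_spans; auto].
  - destruct (valid_dims vR); assert (H1 := @phi_ge0 (width R) (height R)).
    unfold rect_bound, bound, semiperimeter in *.
    destruct (codim1_merge_time vR sQ cQ) as [[? [? ->]]|[? [? ->]]]; lia. }
destruct (decompose SQ bigQ) as [X [Y [[SX SY n HQ] [nX nY]]]].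
destruct (classic (near Y (cell x y))) as [nc|fY].
  apply (@timely_near_part A R Q X Y x y); auto.
destruct (classic (near X (cell x y))) as [nc|fX].
  apply (@timely_near_part A R Q Y X x y); auto; [apply near_sym; auto|rewrite hull_sym; auto].
assert (sX : subrect X Q) by (rewrite -HQ; apply subrect_hull).
assert (sY : subrect Y Q) by (rewrite -HQ hull_sym; apply subrect_hull).
assert (cX := subrect_semiperimeter sX nX); assert (cY := subrect_semiperimeter sY nY).
apply (@timely_far A R Q X Y x y); auto; apply IH; auto; lia.
Qed.
End Planar.

Section Symmetries.
Local Open Scope Z_scope.
Implicit Types (A B : Z -> Z -> Prop) (x y t : Z) (R X Y : rect).

Lemma infected_translate A B a b : (forall u v, A u v -> B (u + a) (v + b)) ->
  forall t x y, plane_infected A t x y -> plane_infected B t (x + a) (y + b).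
Proof.
intros HA t; unfold plane_infected; generalize (Z.to_nat t); intros k.
induction k as [|k IH]; simpl; auto.
intros x y [H|H]; auto; right; revert H; unfold two_nbrs.
replace (x + a - 1) with (x - 1 + a) by lia; replace (x + a + 1) with (x + 1 + a) by lia.
replace (y + b - 1) with (y - 1 + b) by lia; replace (y + b + 1) with (y + 1 + b) by lia.
intuition auto 10.
Qed.

Definition transpose A x y := A y x.
Definition transpose_rect R := Rect (yl R) (yh R) (xl R) (xh R).

Lemma infected_transpose A t x y : plane_infected A t x y -> plane_infected (transpose A) t y x.
Proof.
unfold plane_infected; generalize (Z.to_nat t); intros k; revert x y.
induction k as [|k IH]; simpl; auto.
intros x y [H|H]; auto; right; revert H; unfold two_nbrs.
intuition auto 10.
Qed.

Lemma spanned_transpose A R : spanned A R -> spanned (transpose A) (transpose_rect R).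
Proof.
intros [[v1 v2] [t S]]; split; [split; simpl; auto|].
exists t; intros x y [i1 i2]; simpl in *.
apply (@infected_sub (transpose (restrict A R))).
- intros u v [? [? ?]]; split; auto; split; simpl; lia.
- apply infected_transpose, S; split; lia.
Qed.

End Symmetries.

Section Periodic.
Local Open Scope Z_scope.
Implicit Types (A : Z -> Z -> Prop) (x y t k : Z) (R X Y : rect).

Definition doubly_periodic (n : Z) A := forall k l x y, A x y -> A (x + k * n) (y + l * n).

Lemma periodic_transpose n A : doubly_periodic n A -> doubly_periodic n (transpose A).
Proof. intros H k l x y; apply (H l k). Qed.

Lemma infected_periodic n A t k l x y :
  doubly_periodic n A -> plane_infected A t (x + k * n) (y + l * n) -> plane_infected A t x y.
Proof.
intros H i; replace x with (x + k * n + (- k) * n) by lia.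
replace y with (y + l * n + (- l) * n) by lia.
revert i; apply (@infected_translate A); intros u v; apply H.
Qed.

Definition infects A R t := forall x y, inside R x y -> plane_infected A t x y.
Definition infects_band A R t := forall x y, yl R <= y <= yh R -> plane_infected A t x y.

Lemma spans_infects A R t : spans A R t -> infects A R t.
Proof. intros S x y i; eapply infected_sub; [|apply S; auto]; intros u v []; auto. Qed.

Lemma infects_le A R t t' : t <= t' -> infects A R t -> infects A R t'.
Proof. intros l H x y i; apply (infected_le l); auto. Qed.

Lemma infects_band_le A R t t' : t <= t' -> infects_band A R t -> infects_band A R t'.
Proof. intros l H x y i; apply (infected_le l); auto. Qed.

Lemma reduce_mod n l x : 0 < n -> exists k, l <= x + k * n <= l + n - 1.
Proof.
intros n0; exists (- ((x - l) / n)).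
assert (H1 := Z.div_mod (x - l) n); assert (H2 := Z.mod_pos_bound (x - l) n n0); lia.
Qed.

Lemma wide_band n A R t : 0 < n -> doubly_periodic n A -> n <= width R ->
  infects A R t -> infects_band A R t.
Proof.
intros n0 pA w I x y i; destruct (reduce_mod (xl R) x n0) as [k Hk].
apply (infected_periodic (n := n) (k := k) (l := 0)); auto.
apply I; unfold inside, width in *; lia.
Qed.

Definition shift R k := Rect (xl R + k) (xh R + k) (yl R) (yh R).

Lemma infects_shift n A R k t : doubly_periodic n A -> infects A R t -> infects A (shift R (k * n)) t.
Proof.
intros pA I x y [i1 i2]; simpl in *.
replace x with (x - k * n + k * n) by lia; replace y with (y + 0 * n) by lia.
apply (@infected_translate A); [intros u v; apply pA|]; apply I; split; lia.
Qed.

Ltac rsimpl := cbn [xl xh yl yh hull cell shift transpose_rect] in *.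

Lemma close_shift n R x : 0 < n -> valid R -> exists k,
  2 * gap x x (xl (shift R (k * n))) (xh (shift R (k * n))) <= n /\
  x - n <= xl (shift R (k * n)) <= x + n.
Proof.
intros n0 [v _]; unfold shift; cbn [xl xh]; destruct (reduce_mod (x - n + 1) (xl R) n0) as [k Hk].
destruct (Z.le_gt_cases (2 * (x - (xl R + k * n))) n).
- exists k; unfold gap; lia.
- exists (k + 1); replace ((k + 1) * n) with (k * n + n) by lia; unfold gap; lia.
Qed.

(* Rows fill from the translates of [Y] in both directions, hence [n / 2]. *)
Lemma band_merge n A X Y t d : 0 < n -> 0 <= t -> 0 <= d -> doubly_periodic n A ->
  valid X -> valid Y -> near X Y -> infects_band A X t -> infects A Y t ->
  forall x y, yl (hull X Y) <= y <= yh (hull X Y) -> gap y y (yl X) (yh X) <= d ->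
  plane_infected A (t + (n / 2 + d + 1)) x y.
Proof.
intros n0 t0 d0 pA vX vY nXY IX IY x y hy gy.
assert (n2 := Z.div_mod n 2); assert (n2' := Z.mod_pos_bound n 2).
destruct (classic (yl X <= y <= yh X)) as [i|o]; [apply (infected_le (t := t)); [lia|auto]|].
destruct (close_shift x n0 vY) as [k [Hk1 Hk2]].
set (Y' := shift Y (k * n)) in *.
set (X' := Rect (x - 2 * n) (x + 2 * n) (yl X) (yh X)).
assert (vX' : valid X') by (destruct vX; split; unfold X'; rsimpl; lia).
assert (vY' : valid Y') by (destruct vY; split; unfold Y'; rsimpl; lia).
assert (nXY' : near X' Y').
{ assert (gap (yl X) (yh X) (yl Y) (yh Y) <= 2)
    by (unfold near in nXY; assert (0 <= gap (xl X) (xh X) (xl Y) (xh Y)) by (unfold gap; lia); lia).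
  assert (gap (xl X') (xh X') (xl Y') (xh Y') = 0);
    [|unfold near; unfold X', Y' in *; rsimpl; lia].
  destruct vY'; unfold gap; unfold X' in *; rsimpl; lia. }
assert (iX : forall u v, inside X' u v -> plane_infected A t u v)
  by (intros u v [_ i]; apply IX; auto).
assert (iY : forall u v, inside Y' u v -> plane_infected A t u v) by (apply infects_shift; auto).
assert (D : fill_dom X' Y' x y).
{ split; unfold X', Y'; rsimpl; [lia|]; apply interval_cover in hy; tauto. }
assert (H := merge_cell vX' vY' nXY' iX iY D).
assert (fill_dist X' Y' x y <= n / 2 + d).
{ unfold fill_dist; change (gap y y (yl X') (yh X')) with (gap y y (yl X) (yh X)); lia. }
assert (0 <= fill_dist X' Y' x y) by (unfold fill_dist, gap; lia).
apply infected_comp in H; [|lia|lia]; revert H; apply infected_le; lia.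
Qed.

Lemma bands_merge A X Y t : 0 <= t -> near X Y -> valid X -> valid Y ->
  infects_band A X t -> infects_band A Y t -> infects_band A (hull X Y) (t + 1).
Proof.
intros t0 n [_ vX] [_ vY] IX IY x y hy; rsimpl.
destruct (near_dist n) as [_ _ n1 n2]; clear n.
apply interval_cover in hy; destruct hy as [i|[i|i]].
- apply (infected_le (t := t)); [lia|apply IX; auto].
- apply (infected_le (t := t)); [lia|apply IY; auto].
- apply infected_step; auto; right; left; destruct i; split;
  ((apply IX; lia) || (apply IY; lia)).
Qed.

Lemma phi_band n h : 1 <= h <= n -> phi n (h - 1) + 9 * n <= phi n h.
Proof.
intros H; unfold phi.
repeat match goal with |- context [?u <=? ?v] => destruct (Z.leb_spec u v); try lia end; nia.
Qed.

Lemma bound_mono a b a' b' : 0 <= a <= a' -> 0 <= b <= b' -> bound a b <= bound a' b'.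
Proof. intros; unfold bound; assert (phi a b <= phi a' b') by (apply phi_mono; lia); lia. Qed.

Lemma merge_time_le n X Y : valid X -> valid Y -> near X Y -> width X < n -> width Y < n ->
  height X < n -> height Y < n -> merge_time X (hull X Y) <= 6 * n.
Proof.
intros [? ?] [? ?] nXY w1 w2 h1 h2; destruct (near_dist nXY).
assert (width (hull X Y) <= 2 * n /\ height (hull X Y) <= 2 * n).
{ unfold width, height in *; rsimpl; lia. }
assert (1 <= width (hull X Y) /\ 1 <= height (hull X Y) /\ 1 <= width X /\ 1 <= height X).
{ unfold width, height in *; rsimpl; lia. }
unfold merge_time, if_else0.
destruct (_ <? _), (_ <? _); lia.
Qed.

Definition band_bound n h := bound n h + 180 * n.

Definition timely_band n A R :=
  exists t, [/\ 0 <= t, infects_band A R t & 18 * t <= band_bound n (height R)].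

Lemma timely_band_merge n A X Y : 3 <= n -> doubly_periodic n A -> spanned A Y ->
  valid X -> near X Y -> width Y < n -> height (hull X Y) < n ->
  timely_band n A X -> timely_band n A (hull X Y).
Proof.
intros n3 pA SY vX nXY wY hR [t [t0 It bt]].
destruct (spanned_timely SY) as [s [s0 Ss bs]]; apply spans_infects in Ss.
assert (vY := proj1 SY).
assert (hX : 1 <= height X <= height (hull X Y))
  by (destruct vX; unfold height; rsimpl; lia).
assert (hY : 1 <= height Y <= height (hull X Y))
  by (destruct vY; unfold height; rsimpl; lia).
assert (wY1 := proj1 (valid_dims vY)).
destruct (Z.eq_dec (height X) (height (hull X Y))) as [e|ne].
{ exists t; split; auto; [|rewrite -e; auto].
  intros x y i; apply It; unfold height in e; rsimpl; lia. }
set (d := height (hull X Y) - height X).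
exists (Z.max t s + (n / 2 + d + 1)).
assert (n2 := Z.div_mod n 2); assert (n2' := Z.mod_pos_bound n 2).
split; [lia| |].
- intros x y i; apply (@band_merge n A X Y); auto; try lia.
  + apply (@infects_band_le _ _ t); auto; lia.
  + apply (@infects_le _ _ s); auto; lia.
  + destruct vX as [_ v], vY as [_ v']; assert (H := gap_le v v' i).
    unfold d, height; rsimpl; lia.
- assert (bound (width Y) (height Y) <= bound n (height (hull X Y))) by (apply bound_mono; lia).
  assert (phi n (height X) <= phi n (height (hull X Y) - 1)) by (apply phi_mono; lia).
  assert (H1 := @phi_band n (height (hull X Y))).
  unfold rect_bound, band_bound, bound in *; lia.
Qed.

Theorem spanned_timely_band n A R : 3 <= n -> doubly_periodic n A -> spanned A R ->
  n <= width R -> height R < n -> timely_band n A R.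
Proof.
intros n3 pA.
assert (main : forall k : nat, forall R, semiperimeter R <= Z.of_nat k -> spanned A R ->
  n <= width R -> height R < n -> timely_band n A R).
2: intros S; apply (main (Z.to_nat (semiperimeter R))); auto; lia.
clear R; intros k; induction k as [|k IHk]; intros R Hk SR wR hR.
  destruct (valid_dims (proj1 SR)); unfold semiperimeter in Hk; lia.
assert (big : 2 < semiperimeter R) by (destruct (valid_dims (proj1 SR)); unfold semiperimeter; lia).
destruct (decompose SR big) as [X [Y [[SX SY nXY HR] [nX nY]]]].
assert (sX : subrect X R) by (rewrite -HR; apply subrect_hull).
assert (sY : subrect Y R) by (rewrite -HR hull_sym; apply subrect_hull).
assert (cX := subrect_semiperimeter sX nX); assert (cY := subrect_semiperimeter sY nY).
assert (vX := proj1 SX); assert (vY := proj1 SY).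
destruct (subrect_dims sX) as [wX hX], (subrect_dims sY) as [wY hY].
assert (bX : n <= width X -> timely_band n A X) by (intros; apply IHk; auto; lia).
assert (bY : n <= width Y -> timely_band n A Y) by (intros; apply IHk; auto; lia).
destruct (valid_dims vX), (valid_dims vY).
rewrite -HR in hR *.
destruct (Z.lt_ge_cases (width X) n) as [lX|gX];
destruct (Z.lt_ge_cases (width Y) n) as [lY|gY].
- destruct (spanned_timely SX) as [t [t0 St bt]], (spanned_timely SY) as [s [s0 Ss bs]].
  assert (c := @merge_time_le n X Y vX vY nXY); rewrite HR in hR c.
  assert (c0 := merge_time_ge0 (valid_hull vX vY) (subrect_hull X Y)).
  exists (Z.max t s + merge_time X (hull X Y)); split; [lia| |].
  + apply (@wide_band n); auto; [lia|rewrite HR; auto|].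
    apply spans_infects, spans_merge_merge_time; auto; [lia| |].
    * apply (spans_le (t := t)); auto; lia.
    * apply (spans_le (t := s)); auto; lia.
  + assert (bound (width X) (height X) <= bound n (height R)) by (apply bound_mono; lia).
    assert (bound (width Y) (height Y) <= bound n (height R)) by (apply bound_mono; lia).
    rewrite HR; unfold rect_bound, band_bound in *; lia.
- rewrite hull_sym in hR *; apply timely_band_merge; auto; apply near_sym; auto.
- apply timely_band_merge; auto.
- destruct (bX gX) as [t [t0 It bt]], (bY gY) as [s [s0 Is bs]].
  destruct (Z.eq_dec (height X) (height (hull X Y))) as [e|ne].
  { exists t; split; auto; [|rewrite -e; auto].
    intros x y i; apply It; destruct vX, vY; unfold height in e; rsimpl; lia. }
  destruct (Z.eq_dec (height Y) (height (hull X Y))) as [e|ne'].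
  { exists s; split; auto; [|rewrite -e; auto].
    intros x y i; apply Is; destruct vX, vY; unfold height in e; rsimpl; lia. }
  rewrite -HR in hX hY.
  exists (Z.max t s + 1); split; [lia| |].
  + apply bands_merge; auto; [lia| |].
    * apply (@infects_band_le _ _ t); auto; lia.
    * apply (@infects_band_le _ _ s); auto; lia.
  + assert (phi n (height X) <= phi n (height (hull X Y))) by (apply phi_mono; lia).
    assert (phi n (height Y) <= phi n (height (hull X Y))) by (apply phi_mono; lia).
    unfold band_bound, bound in *; lia.
Qed.

Definition everywhere A t := forall x y, plane_infected A t x y.

Lemma everywhere_transpose A t : everywhere (transpose A) t -> everywhere A t.
Proof. intros H x y; exact (infected_transpose (H y x)). Qed.

Lemma spanned_infects_bound n A X : 3 <= n -> doubly_periodic n A -> spanned A X ->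
  width X < n \/ height X < n ->
  exists t, [/\ 0 <= t, infects A X t & 18 * t <= bound n n + 180 * n].
Proof.
intros n3 pA SX small; destruct (valid_dims (proj1 SX)).
assert (mono : forall a b, 0 <= a <= n -> 0 <= b <= n -> bound a b <= bound n n)
  by (intros; apply bound_mono; lia).
destruct (Z.lt_ge_cases (width X) n) as [lw|gw].
- destruct (Z.lt_ge_cases (height X) n) as [lh|gh].
    destruct (spanned_timely SX) as [t [t0 St bt]]; exists t; split; auto.
      apply spans_infects; auto.
    assert (H1 := mono (width X) (height X)); unfold rect_bound in bt; lia.
  destruct (@spanned_timely_band n (transpose A) (transpose_rect X)) as [t [t0 St bt]]; auto.
    apply periodic_transpose; auto.
    apply spanned_transpose; auto.
  exists t; split; auto.
    intros x y [i1 i2]; exact (infected_transpose (St y x i1)).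
  assert (H1 := mono n (width X)); unfold band_bound in bt.
  change (height (transpose_rect X)) with (width X) in bt; lia.
- destruct (@spanned_timely_band n A X) as [t [t0 St bt]]; auto; [lia|].
  exists t; split; auto.
    intros x y [i1 i2]; apply St; auto.
  assert (H1 := mono n (height X)); unfold band_bound in bt; lia.
Qed.

Definition total_bound n := bound n n + 360 * n.

Lemma wide_merge_everywhere n A X Y : 3 <= n -> doubly_periodic n A ->
  spanned A X -> spanned A Y -> near X Y -> n <= width X -> height X < n ->
  width Y < n \/ height Y < n -> n <= height (hull X Y) ->
  exists t, [/\ 0 <= t, everywhere A t & 18 * t <= total_bound n].
Proof.
intros n3 pA SX SY nXY wX hX sY hR.
destruct (@spanned_infects_bound n A X) as [t [t0 It bt]]; auto.
destruct (@spanned_infects_bound n A Y) as [s [s0 Is bs]]; auto.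
apply (@wide_band n) in It; auto; [|lia].
assert (vX := proj1 SX); assert (vY := proj1 SY).
exists (Z.max t s + (n / 2 + n + 1)).
assert (n2 := Z.div_mod n 2); assert (n2' := Z.mod_pos_bound n 2).
split; [lia| |unfold total_bound; lia].
intros x y.
set (R := hull X Y) in *.
assert (yl R <= yl X /\ yh X <= yh R) as [r1 r2] by (unfold R; rsimpl; lia).
set (l := Z.max (yl R) (yh X - n + 1)).
assert (n0 : 0 < n) by lia.
destruct (reduce_mod (l) y n0) as [k Hk].
apply (infected_periodic (n := n) (k := 0) (l := k)); auto.
apply (@band_merge n A X Y); auto; try lia.
- apply (@infects_band_le _ _ t); auto; lia.
- apply (@infects_le _ _ s); auto; lia.
- unfold height in hR, hX; fold R; lia.
- destruct vX as [_ v]; unfold height in hR, hX; unfold gap; lia.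
Qed.

Theorem spanned_everywhere n A R : 3 <= n -> doubly_periodic n A -> spanned A R ->
  n <= width R -> n <= height R ->
  exists t, [/\ 0 <= t, everywhere A t & 18 * t <= total_bound n].
Proof.
intros n3 pA.
assert (main : forall k : nat, forall R, semiperimeter R <= Z.of_nat k -> spanned A R ->
  n <= width R -> n <= height R ->
  exists t, [/\ 0 <= t, everywhere A t & 18 * t <= total_bound n]).
2: intros S; apply (main (Z.to_nat (semiperimeter R))); auto; lia.
clear R; intros k; induction k as [|k IHk]; intros R Hk SR wR hR.
  unfold semiperimeter in Hk; lia.
assert (big : 2 < semiperimeter R) by (unfold semiperimeter; lia).
destruct (decompose SR big) as [X [Y [[SX SY nXY HR] [nX nY]]]].
assert (sX : subrect X R) by (rewrite -HR; apply subrect_hull).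
assert (sY : subrect Y R) by (rewrite -HR hull_sym; apply subrect_hull).
assert (cX := subrect_semiperimeter sX nX); assert (cY := subrect_semiperimeter sY nY).
assert (vX := proj1 SX); assert (vY := proj1 SY).
destruct (classic (n <= width X /\ n <= height X)) as [[? ?]|bX].
  apply (IHk X); auto; lia.
destruct (classic (n <= width Y /\ n <= height Y)) as [[? ?]|bY].
  apply (IHk Y); auto; lia.
assert (nYX := near_sym nXY).
assert (HR' : hull Y X = R) by (rewrite hull_sym; auto).
destruct (Z.le_gt_cases n (width X)) as [gX|lX].
  apply (@wide_merge_everywhere n A X Y); auto; [lia|lia|rewrite HR; auto].
destruct (Z.le_gt_cases n (width Y)) as [gY|lY].
  apply (@wide_merge_everywhere n A Y X); auto; [lia|rewrite HR'; auto].
assert (tall : forall U V, spanned A U -> spanned A V -> near U V -> hull U V = R ->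
  width U < n -> width V < n -> n <= height U ->
  exists t, [/\ 0 <= t, everywhere A t & 18 * t <= total_bound n]).
{ intros U V SU SV nUV HUV wU wV hU.
  destruct (@wide_merge_everywhere n (transpose A) (transpose_rect U) (transpose_rect V))
    as [t [t0 Et bt]]; auto.
  - apply periodic_transpose; auto.
  - apply spanned_transpose; auto.
  - apply spanned_transpose; auto.
  - unfold near in *; rsimpl; lia.
  - rewrite -HUV in wR; exact wR.
  - exists t; split; auto; apply everywhere_transpose; auto. }
destruct (Z.le_gt_cases n (height X)) as [hX|hX]; [apply (tall X Y); auto|].
destruct (Z.le_gt_cases n (height Y)) as [hY|hY]; [apply (tall Y X); auto|].
destruct (@spanned_infects_bound n A X) as [t [t0 It bt]]; auto.
destruct (@spanned_infects_bound n A Y) as [s [s0 Is bs]]; auto.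
assert (c := @merge_time_le n X Y vX vY nXY lX lY hX hY).
assert (c0 := merge_time_ge0 (valid_hull vX vY) (subrect_hull X Y)).
exists (Z.max t s + merge_time X (hull X Y)); split; [lia| |unfold total_bound; lia].
assert (IR : infects A R (Z.max t s + merge_time X (hull X Y))).
{ rewrite -HR; intros x y i; apply infected_comp; [lia|lia|]; apply merge_merge_time; auto.
  - apply (@infects_le _ _ t); auto; lia.
  - apply (@infects_le _ _ s); auto; lia. }
assert (n0 : 0 < n) by lia.
intros x y; destruct (reduce_mod (xl R) x n0) as [i Hi].
destruct (reduce_mod (yl R) y n0) as [j Hj].
apply (infected_periodic (n := n) (k := i) (l := j)); auto.
apply IR; unfold inside, width, height in *; lia.
Qed.

Definition translate R a b := Rect (xl R + a) (xh R + a) (yl R + b) (yh R + b).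

Lemma spanned_translate n A R k l : doubly_periodic n A -> spanned A R ->
  spanned A (translate R (k * n) (l * n)).
Proof.
intros pA [[v1 v2] [t S]]; split; [split; cbn; lia|].
exists t; intros x y [i1 i2]; cbn in i1, i2.
replace x with (x - k * n + k * n) by lia; replace y with (y - l * n + l * n) by lia.
apply (@infected_translate (restrict A R)); [|apply S; split; lia].
intros u v [H [? ?]]; split; [apply pA; auto | split; cbn; lia].
Qed.

Lemma everywhere_spanned A t (n : nat) : everywhere A t ->
  exists2 R, spanned A R & inside R 0 0 /\ inside R (Z.of_nat n) (Z.of_nat n).
Proof.
intros E.
assert (cov : forall x y, covered (spanned A) x y).
{ intros x y; generalize (E x y); apply infected_invariant.
  - intros u v H; exists (cell u v); [apply cell_spanned; auto | split; rsimpl; lia].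
  - apply covered_closed; intros; apply spanned_hull; auto. }
induction n as [|n [R SR [i0 i1]]].
  destruct (cov 0 0) as [X SX iX]; exists X; auto.
destruct (cov (Z.of_nat n.+1) (Z.of_nat n.+1)) as [X SX iX].
exists (hull R X).
- apply spanned_hull; auto; eapply near_points; eauto; lia.
- split; [destruct i0 | destruct iX]; split; rsimpl; lia.
Qed.

Theorem periodic_upper_bound n A t : 3 <= n -> doubly_periodic n A -> everywhere A t ->
  exists t', [/\ 0 <= t', everywhere A t' & 18 * t' <= 13 * n * n + 720 * n].
Proof.
intros n3 pA E; destruct (everywhere_spanned (Z.to_nat n) E) as [R SR [[i1 i2] [j1 j2]]].
destruct (@spanned_everywhere n A R) as [t' [H1 H2 H3]]; auto.
- unfold width; lia.
- unfold height; lia.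
exists t'; split; auto; revert H3; unfold total_bound, bound, phi.
destruct (Z.leb_spec n n); [|lia]; destruct (Z.leb_spec (3 * n) n); lia.
Qed.

End Periodic.

Section Confinement.
Local Open Scope Z_scope.
Implicit Types (A B D F : Z -> Z -> Prop) (x y t : Z).

Lemma mod_succ n x : 2 <= n ->
  x mod n = n - 1 /\ (x + 1) mod n = 0 \/ x mod n < n - 1 /\ (x + 1) mod n = x mod n + 1.
Proof.
intros n2; rewrite -(Z.add_mod_idemp_l x); [|lia].
assert (H := Z.mod_pos_bound x n).
destruct (Z.eq_dec (x mod n) (n - 1)) as [->|ne].
  left; split; auto; replace (n - 1 + 1) with n by lia; apply Z.mod_same; lia.
right; split; [lia|]; apply Z.mod_small; lia.
Qed.

Lemma mod_pred n x : 2 <= n ->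
  x mod n = 0 /\ (x - 1) mod n = n - 1 \/ 0 < x mod n /\ (x - 1) mod n = x mod n - 1.
Proof.
intros n2; assert (H := mod_succ (x - 1) n2); replace (x - 1 + 1) with x in H by lia.
assert (H1 := Z.mod_pos_bound (x - 1) n); lia.
Qed.

(* [F] avoids the last column and row, and reaches into the first column and
   the last but one row only at one cell: no cell sees [F] twice across the seam. *)
Definition confined n F := forall x y, F x y ->
  1 <= x <= n - 2 /\ 0 <= y <= n - 3 \/ x = 0 /\ y = n - 2.

Definition wrap_mod n F x y := F (x mod n) (y mod n).

Lemma two_nbrs_wrap n F x y : 3 <= n -> confined n F -> two_nbrs (wrap_mod n F) x y ->
  two_nbrs F (x mod n) (y mod n).
Proof.
intros n3 cF; unfold two_nbrs, wrap_mod.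
assert (n2 : 2 <= n) by lia.
assert (sx := mod_succ x n2); assert (px := mod_pred x n2).
assert (sy := mod_succ y n2); assert (py := mod_pred y n2).
set (x0 := x mod n) in *; set (y0 := y mod n) in *.
set (x1 := (x - 1) mod n) in *; set (x2 := (x + 1) mod n) in *.
set (y1 := (y - 1) mod n) in *; set (y2 := (y + 1) mod n) in *.
clearbody x0 y0 x1 x2 y1 y2.
assert (L : F x1 y0 -> F (x0 - 1) y0).
{ intros H; destruct px as [[? e]|[_ e]]; [|rewrite -e; auto].
  exfalso; destruct (cF _ _ H); lia. }
assert (D : F x0 y1 -> F x0 (y0 - 1)).
{ intros H; destruct py as [[? e]|[_ e]]; [|rewrite -e; auto].
  exfalso; destruct (cF _ _ H); lia. }
assert (R : F x2 y0 -> F (x0 + 1) y0 \/ x0 = n - 1 /\ y0 = n - 2).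
{ intros H; destruct sx as [[? e]|[_ e]]; [|left; rewrite -e; auto].
  right; destruct (cF _ _ H); lia. }
assert (U : F x0 y2 -> F x0 (y0 + 1) \/ y0 = n - 1 /\ 1 <= x0 <= n - 2).
{ intros H; destruct sy as [[? e]|[_ e]]; [|left; rewrite -e; auto].
  right; destruct (cF _ _ H); lia. }
intros [[a b]|[[a b]|[[a b]|[[a b]|[[a b]|[a b]]]]]].
- destruct (R b); [left; auto|]; exfalso; destruct (cF _ _ (L a)); lia.
- destruct (U b); [right; left; auto|]; exfalso; destruct (cF _ _ (D a)); lia.
- right; right; left; auto.
- destruct (U b); [tauto|]; exfalso; destruct (cF _ _ (L a)); lia.
- destruct (R a); [tauto|]; exfalso; destruct (cF _ _ (D b)); lia.
- destruct (R a) as [a'|a'], (U b) as [b'|b']; [tauto| | |]; exfalso.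
  + destruct (cF _ _ a'); lia.
  + destruct (cF _ _ b'); lia.
  + lia.
Qed.

Definition within n A t F := 0 <= t /\ forall x y, plane_infected A t x y -> wrap_mod n F x y.

Lemma within_weaken n A t F G : (forall x y, F x y -> G x y) ->
  within n A t F -> within n A t G.
Proof. intros s [t0 H]; split; auto; intros x y i; apply s, H; auto. Qed.

Lemma within_step n A t F G : 3 <= n -> confined n F -> (forall x y, F x y -> G x y) ->
  (forall x y, two_nbrs F x y -> G x y) -> within n A t F -> within n A (t + 1) G.
Proof.
intros n3 cF s1 s2 [t0 H]; split; [lia|]; intros x y; unfold plane_infected.
replace (Z.to_nat (t + 1)) with (S (Z.to_nat t)) by lia; simpl; intros [i|i].
- apply s1, H; auto.
- apply s2, two_nbrs_wrap; auto; revert i; apply two_nbrs_mono; auto.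
Qed.

Definition l1_dist x y x' y' := Z.abs (x - x') + Z.abs (y - y').

Definition separated D := forall x y x' y', D x y -> D x' y' ->
  (x = x' /\ y = y') \/ 3 <= l1_dist x y x' y'.

Definition far B D := forall x y x' y', B x y -> D x' y' ->
  B x' y' \/ 3 <= l1_dist x y x' y'.

Definition join B D x y := B x y \/ D x y.

Lemma two_nbrs_join B B' D x y : far B D -> separated D ->
  (forall x y, two_nbrs B x y -> B' x y) ->
  two_nbrs (join B D) x y -> join B' D x y.
Proof.
intros fBD sD s H; left; apply s; revert H; unfold two_nbrs, join.
assert (f2 : forall x y x' y', (B x y \/ D x y) -> (B x' y' \/ D x' y') ->
  (x <> x' \/ y <> y') -> l1_dist x y x' y' <= 2 -> B x y /\ B x' y').
{ intros u v u' v' [b|d] [b'|d'] ne l; auto.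
  - destruct (fBD _ _ _ _ b d'); [auto|lia].
  - destruct (fBD _ _ _ _ b' d); [auto|]; unfold l1_dist in *; lia.
  - destruct (sD _ _ _ _ d d'); lia. }
unfold l1_dist in f2.
intros [[a b]|[[a b]|[[a b]|[[a b]|[[a b]|[a b]]]]]];
destruct (f2 _ _ _ _ a b); try lia; tauto.
Qed.

Definition stack l r h p q k x y :=
  l <= x <= r /\ 0 <= y < h \/ p <= x <= q /\ h <= y < h + k.

Ltac stack_lia := unfold stack, two_nbrs in *; intros x y;
  intros [[a b]|[[a b]|[[a b]|[[a b]|[[a b]|[a b]]]]]];
  destruct a as [a|a]; destruct b as [b|b]; lia.

Lemma stack_leftward l r h p x y : l < p <= r ->
  two_nbrs (stack l r h p r 1) x y -> stack l r h (p - 1) r 1 x y.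
Proof. intros H; revert x y; stack_lia. Qed.

Lemma stack_rightward l r h q k x y : 1 <= k -> l <= q < r ->
  two_nbrs (stack l r h l q k) x y -> stack l r h l (q + 1) k x y.
Proof. intros H H'; revert x y; stack_lia. Qed.

Lemma sweep_leftward n A D l r h t : 3 <= n -> separated D -> l <= r ->
  (forall p, l < p <= r -> confined n (join (stack l r h p r 1) D)) ->
  (forall p, l < p <= r -> far (stack l r h p r 1) D) ->
  within n A t (join (stack l r h r r 1) D) ->
  within n A (t + (r - l)) (join (stack l r h l r 1) D).
Proof.
intros n3 sD lr cF fF W.
assert (main : forall k : nat, Z.of_nat k <= r - l ->
  within n A (t + Z.of_nat k) (join (stack l r h (r - Z.of_nat k) r 1) D)).
2:{ assert (H := main (Z.to_nat (r - l))); rewrite Z2Nat.id in H; [|lia].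
    replace (r - (r - l)) with l in H by lia; apply H; lia. }
intros k; induction k as [|k IH]; intros Hk.
  replace (t + Z.of_nat 0) with t by lia; replace (r - Z.of_nat 0) with r by lia; auto.
replace (t + Z.of_nat k.+1) with (t + Z.of_nat k + 1) by lia.
replace (r - Z.of_nat k.+1) with (r - Z.of_nat k - 1) by lia.
set (p := r - Z.of_nat k) in *.
apply (@within_step n A _ (join (stack l r h p r 1) D)); auto.
- apply cF; lia.
- intros x y [[H|H]|H]; [left; left|left; right|right]; auto; lia.
- intros x y; apply two_nbrs_join; auto; [apply fF; lia|].
  intros u v; apply stack_leftward; lia.
- apply IH; lia.
Qed.

Lemma sweep_rightward n A D l r h k q q' t : 3 <= n -> separated D -> 1 <= k ->
  l <= q <= q' -> q' <= r ->
  (forall p, l <= p < q' -> confined n (join (stack l r h l p k) D)) ->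
  (forall p, l <= p < q' -> far (stack l r h l p k) D) ->
  within n A t (join (stack l r h l q k) D) ->
  within n A (t + (q' - q)) (join (stack l r h l q' k) D).
Proof.
intros n3 sD k1 lq qr cF fF W.
assert (main : forall j : nat, Z.of_nat j <= q' - q ->
  within n A (t + Z.of_nat j) (join (stack l r h l (q + Z.of_nat j) k) D)).
2:{ assert (H := main (Z.to_nat (q' - q))); rewrite Z2Nat.id in H; [|lia].
    replace (q + (q' - q)) with q' in H by lia; apply H; lia. }
intros j; induction j as [|j IH]; intros Hj.
  replace (t + Z.of_nat 0) with t by lia; replace (q + Z.of_nat 0) with q by lia; auto.
replace (t + Z.of_nat j.+1) with (t + Z.of_nat j + 1) by lia.
replace (q + Z.of_nat j.+1) with (q + Z.of_nat j + 1) by lia.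
set (p := q + Z.of_nat j) in *.
apply (@within_step n A _ (join (stack l r h l p k) D)); auto.
- apply cF; lia.
- intros x y [[H|H]|H]; [left; left|left; right|right]; auto; lia.
- intros x y; apply two_nbrs_join; auto; [apply fF; lia|].
  intros u v; apply stack_rightward; lia.
- apply IH; lia.
Qed.
End Confinement.

Section Construction.
Local Open Scope Z_scope.
Implicit Types x y t : Z.

(* Final width [m]; [2 c + 1] corner steps from a block of height [h0], then
   [q] times three rows. *)
Variables m c q h0 : Z.
Hypotheses (c0 : 0 <= c) (q1 : 1 <= q) (h1 : 1 <= h0) (mc : 6 * c <= m) (m9 : 9 <= m)
  (mq : h0 + 2 * c + 1 + 3 * q = m).
Let n := m + 2.
Let l0 := c + 1.
Let r0 := m - c - 1.
Let H := h0 + 2 * c + 1.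

Inductive seed x y : Prop :=
| SeedRight j of 0 <= j <= c & x = r0 + j + 1 & y = h0 + 2 * j
| SeedLeft j of 0 <= j < c & x = l0 - j - 1 & y = h0 + 2 * j + 1
| SeedGap j of 0 <= j < q & x = 1 & y = H + 3 * j + 1
| SeedAdj j of 0 <= j < q & x = m & y = H + 3 * j + 2
| SeedLast of x = 0 & y = m.

Definition block x y := l0 <= x <= r0 /\ 0 <= y < h0.
Definition start := wrap_mod n (join block seed).

Lemma seed_separated : separated seed.
Proof.
intros x y x' y' s s'; unfold l1_dist, r0, l0, H in *.
destruct s as [j ? ? ?|j ? ? ?|j ? ? ?|j ? ? ?|? ?];
destruct s' as [j' ? ? ?|j' ? ? ?|j' ? ? ?|j' ? ? ?|? ?];
first [ left; lia | right; lia | 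
  destruct (Z.eq_dec j j'); [left; lia | right; lia] ].
Qed.

Lemma seed_confined B : (forall x y, B x y -> 1 <= x <= m /\ 0 <= y < m) ->
  confined n (join B seed).
Proof.
intros HB x y [b|s]; [left; specialize (HB _ _ b); unfold n; lia|].
unfold n, r0, l0, H in *; destruct s; [left|left|left|left|right]; lia.
Qed.

Ltac far_lia j := intros x y x' y' b s; unfold stack, l1_dist, r0, l0, H in *;
  destruct b as [b|b]; destruct s as [i ? ? ?|i ? ? ?|i ? ? ?|i ? ? ?|? ?];
  first [right; lia |
         destruct (Z.lt_trichotomy i j) as [?|[?|?]];
         first [right; lia | left; left; lia | left; right; lia]].

Lemma far_right j p : 0 <= j <= c -> l0 - j < p <= r0 + j + 1 ->
  far (stack (l0 - j) (r0 + j + 1) (h0 + 2 * j) p (r0 + j + 1) 1) seed.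
Proof. intros Hj Hp; far_lia j. Qed.

Lemma far_left j p : 0 <= j < c -> l0 - j - 1 <= p < r0 + j + 1 ->
  far (stack (l0 - j - 1) (r0 + j + 1) (h0 + 2 * j + 1) (l0 - j - 1) p 1) seed.
Proof. intros Hj Hp; far_lia j. Qed.

Lemma far_gap j p : 0 <= j < q -> 1 <= p < m - 1 ->
  far (stack 1 m (H + 3 * j) 1 p 2) seed.
Proof. intros Hj Hp; far_lia j. Qed.

Lemma far_adj j p : 0 <= j < q -> 1 < p <= m ->
  far (stack 1 m (H + 3 * j + 2) p m 1) seed.
Proof. intros Hj Hp; far_lia j. Qed.

Definition full l r h x y := l <= x <= r /\ 0 <= y < h.

Ltac weaken := apply within_weaken; intros x y [?|?]; [left|right; assumption];
  unfold full, block, stack, l0, r0, H in *; lia.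

Lemma conf_stack l r h p p' k : 1 <= l -> r <= m -> 1 <= p -> p' <= m -> 0 <= h -> 0 <= k -> 
  h + k <= m -> confined n (join (stack l r h p p' k) seed).
Proof.
intros; apply seed_confined; intros x y [?|?]; lia.
Qed.

Let n3 : 3 <= n.
Proof. unfold n; lia. Qed.

Lemma start_within : within n start 0 (join (full l0 r0 h0) seed).
Proof. split; [lia|]; intros x y i; apply infected0 in i; exact i. Qed.

Lemma within_right j t : 0 <= j <= c ->
  within n start t (join (full (l0 - j) (r0 + j) (h0 + 2 * j)) seed) ->
  within n start (t + (r0 + 2 * j + 1 - l0))
    (join (full (l0 - j) (r0 + j + 1) (h0 + 2 * j + 1)) seed).
Proof.
intros Hj W.
assert (W' : within n start t
  (join (stack (l0 - j) (r0 + j + 1) (h0 + 2 * j) (r0 + j + 1) (r0 + j + 1) 1) seed))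
  by (revert W; weaken).
apply sweep_leftward in W'; auto using seed_separated.
- replace (t + (r0 + 2 * j + 1 - l0)) with (t + (r0 + j + 1 - (l0 - j))) by lia.
  revert W'; weaken.
- unfold l0, r0; lia.
- intros p Hp; apply conf_stack; unfold l0, r0, H in *; lia.
- intros p Hp; apply far_right; lia.
Qed.

Lemma within_left j t : 0 <= j < c ->
  within n start t (join (full (l0 - j) (r0 + j + 1) (h0 + 2 * j + 1)) seed) ->
  within n start (t + (r0 + 2 * j + 2 - l0))
    (join (full (l0 - (j + 1)) (r0 + (j + 1)) (h0 + 2 * (j + 1))) seed).
Proof.
intros Hj W.
assert (W' : within n start t
  (join (stack (l0 - j - 1) (r0 + j + 1) (h0 + 2 * j + 1) (l0 - j - 1) (l0 - j - 1) 1) seed))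
  by (revert W; weaken).
apply (@sweep_rightward n start seed _ _ _ _ _ (r0 + j + 1)) in W';
  auto using seed_separated; try lia.
- replace (t + (r0 + 2 * j + 2 - l0)) with (t + (r0 + j + 1 - (l0 - j - 1))) by lia.
  revert W'; weaken.
- intros p Hp; apply conf_stack; unfold l0, r0, H in *; lia.
- intros p Hp; apply far_left; lia.
Qed.

Lemma within_rows3 j t : 0 <= j < q ->
  within n start t (join (full 1 m (H + 3 * j)) seed) ->
  within n start (t + (2 * m - 3)) (join (full 1 m (H + 3 * (j + 1))) seed).
Proof.
intros Hj W.
assert (W' : within n start t (join (stack 1 m (H + 3 * j) 1 1 2) seed))
  by (revert W; weaken).
apply (@sweep_rightward n start seed _ _ _ _ _ (m - 1)) in W'; auto using seed_separated; try lia.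
- assert (W2 : within n start (t + (m - 1 - 1)) (join (stack 1 m (H + 3 * j + 2) m m 1) seed))
    by (revert W'; weaken).
  apply sweep_leftward in W2; auto using seed_separated; try lia.
  + replace (t + (2 * m - 3)) with (t + (m - 1 - 1) + (m - 1)) by lia.
    revert W2; weaken.
  + intros p Hp; apply conf_stack; unfold l0, r0, H in *; lia.
  + intros p Hp; apply far_adj; lia.
- intros p Hp; apply conf_stack; unfold l0, r0, H in *; lia.
- intros p Hp; apply far_gap; lia.
Qed.

Let w0 := m - 2 * c - 1.

Lemma within_corners (j : nat) : Z.of_nat j <= c ->
  within n start (2 * w0 * Z.of_nat j + 2 * Z.of_nat j * (Z.of_nat j - 1) + Z.of_nat j)
   (join (full (l0 - Z.of_nat j) (r0 + Z.of_nat j) (h0 + 2 * Z.of_nat j)) seed).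
Proof.
induction j as [|j IH]; intros Hj.
  assert (W := start_within).
  replace (2 * w0 * Z.of_nat 0 + 2 * Z.of_nat 0 * (Z.of_nat 0 - 1) + Z.of_nat 0) with 0 by lia.
  revert W; weaken.
assert (W := IH); destruct IH; [lia|].
assert (Hj' : 0 <= Z.of_nat j <= c) by lia; assert (Hj'' : 0 <= Z.of_nat j < c) by lia.
assert (W2 := within_left Hj'' (within_right Hj' (W ltac:(lia)))).
replace (Z.of_nat j.+1) with (Z.of_nat j + 1) by lia.
set (J := Z.of_nat j) in *.
match type of W2 with within _ _ ?u _ => match goal with |- within _ _ ?v _ =>
  replace v with u; [exact W2|] end end.
unfold w0, r0, l0; ring.
Qed.

Definition slow_time :=
  2 * w0 * c + 2 * c * (c - 1) + c + (w0 + 2 * c) + q * (2 * m - 3).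

Lemma within_all (j : nat) : Z.of_nat j <= q ->
  within n start (2 * w0 * c + 2 * c * (c - 1) + c + (w0 + 2 * c) + Z.of_nat j * (2 * m - 3))
   (join (full 1 m (H + 3 * Z.of_nat j)) seed).
Proof.
induction j as [|j IH]; intros Hj.
  assert (W := @within_corners (Z.to_nat c)); rewrite Z2Nat.id in W; auto.
  assert (cc : 0 <= c <= c) by lia.
  assert (W2 := within_right cc (W (Z.le_refl c))).
  match type of W2 with within _ _ ?u _ => match goal with |- within _ _ ?v _ =>
    replace v with u end end; [revert W2; weaken|].
  unfold w0, r0, l0; lia.
assert (Hj' : 0 <= Z.of_nat j < q) by lia.
assert (W := within_rows3 Hj' (IH ltac:(lia))).
replace (Z.of_nat j.+1) with (Z.of_nat j + 1) by lia.
match type of W with within _ _ ?u _ => match goal with |- within _ _ ?v _ =>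
  replace v with u; [exact W|] end end.
ring.
Qed.

Lemma slow_origin : ~ plane_infected start slow_time 0 0.
Proof.
intros i; assert (W := @within_all (Z.to_nat q)); rewrite Z2Nat.id in W; [|lia].
destruct (W (Z.le_refl q)) as [_ W']; specialize (W' 0 0 i).
unfold wrap_mod in W'; rewrite Z.mod_0_l in W'; [|unfold n; lia].
destruct W' as [[? ?]|s]; [lia|]; unfold r0, l0, H in *; destruct s; lia.
Qed.

Lemma start_periodic : doubly_periodic n start.
Proof. intros k l x y; unfold start, wrap_mod; rewrite !Z.mod_add; auto; unfold n; lia. Qed.

Lemma start_seed x y : 0 <= x <= m -> 0 <= y <= m -> seed x y -> start x y.
Proof.
intros Hx Hy s; unfold start, wrap_mod; rewrite !Z.mod_small; [right; auto| |]; unfold n; lia.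
Qed.

Lemma grow R x y R' : spanned start R -> start x y -> near R (cell x y) ->
  hull R (cell x y) = R' -> spanned start R'.
Proof. intros SR s nr <-; apply spanned_hull; auto; apply cell_spanned; auto. Qed.

Ltac grow_by W x y s := apply (@grow _ x y _ W);
  [ apply start_seed; [| |apply s]; unfold l0, r0, H in *; lia
  | unfold near, gap, cell, l0, r0, H in *; cbn [xl xh yl yh]; lia
  | apply rect_eq; unfold hull, cell, l0, r0, H in *; cbn [xl xh yl yh]; lia ].

Lemma spanned_right j : 0 <= j <= c ->
  spanned start (Rect (l0 - j) (r0 + j) 0 (h0 + 2 * j - 1)) ->
  spanned start (Rect (l0 - j) (r0 + j + 1) 0 (h0 + 2 * j)).
Proof.
intros Hj W; grow_by W (r0 + j + 1) (h0 + 2 * j) (@SeedRight (r0 + j + 1) (h0 + 2 * j) j).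
Qed.

Lemma spanned_left j : 0 <= j < c ->
  spanned start (Rect (l0 - j) (r0 + j + 1) 0 (h0 + 2 * j)) ->
  spanned start (Rect (l0 - (j + 1)) (r0 + (j + 1)) 0 (h0 + 2 * (j + 1) - 1)).
Proof.
intros Hj W; grow_by W (l0 - j - 1) (h0 + 2 * j + 1) (@SeedLeft (l0 - j - 1) (h0 + 2 * j + 1) j).
Qed.

Lemma spanned_rows2 j : 0 <= j < q ->
  spanned start (Rect 1 m 0 (H + 3 * j - 1)) -> spanned start (Rect 1 m 0 (H + 3 * j + 1)).
Proof. intros Hj W; grow_by W 1 (H + 3 * j + 1) (@SeedGap 1 (H + 3 * j + 1) j). Qed.

Lemma spanned_rows3 j : 0 <= j < q ->
  spanned start (Rect 1 m 0 (H + 3 * j + 1)) ->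
  spanned start (Rect 1 m 0 (H + 3 * (j + 1) - 1)).
Proof. intros Hj W; grow_by W m (H + 3 * j + 2) (@SeedAdj m (H + 3 * j + 2) j). Qed.

Lemma spanned_corners (j : nat) : Z.of_nat j <= c ->
  spanned start (Rect (l0 - Z.of_nat j) (r0 + Z.of_nat j) 0 (h0 + 2 * Z.of_nat j - 1)).
Proof.
induction j as [|j IH]; intros Hj.
  split; [split; cbn; unfold l0, r0; lia|]; exists 0; intros x y [i1 i2].
  cbn in i1, i2; apply infected_init; split; [|split; auto].
  unfold start, wrap_mod; rewrite !Z.mod_small; unfold n, l0, r0 in *;
    [left; split; unfold l0, r0; lia | lia | lia].
replace (Z.of_nat j.+1) with (Z.of_nat j + 1) by lia.
apply spanned_left; [lia|]; apply spanned_right; [lia|]; apply IH; lia.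
Qed.

Lemma spanned_all (j : nat) : Z.of_nat j <= q ->
  spanned start (Rect 1 m 0 (H + 3 * Z.of_nat j - 1)).
Proof.
induction j as [|j IH]; intros Hj.
  assert (W := @spanned_corners (Z.to_nat c)); rewrite Z2Nat.id in W; auto.
  assert (cc : 0 <= c <= c) by lia.
  assert (W2 := spanned_right cc (W (Z.le_refl c))).
  match type of W2 with spanned _ ?u => match goal with |- spanned _ ?v =>
    replace v with u; [exact W2|apply rect_eq; cbn [xl xh yl yh]; unfold l0, r0, H; lia] end end.
replace (Z.of_nat j.+1) with (Z.of_nat j + 1) by lia.
apply spanned_rows3; [lia|]; apply spanned_rows2; [lia|]; apply IH; lia.
Qed.

Lemma start_percolates : exists t, everywhere start t.
Proof.
assert (W := @spanned_all (Z.to_nat q)); rewrite Z2Nat.id in W; [|lia].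
specialize (W (Z.le_refl q)).
assert (W1 : spanned start (Rect 0 m 0 m)).
{ grow_by W 0 m (@SeedLast 0 m). }
assert (W2 : spanned start (Rect 0 (m + n) 0 m)).
{ assert (S := spanned_translate 1 0 start_periodic W1).
  assert (S' := spanned_hull W1 S).
  match type of S' with _ -> spanned _ ?u => replace (Rect 0 (m + n) 0 m) with u end.
  - apply S'; unfold near, gap, translate; cbn [xl xh yl yh]; unfold n; lia.
  - apply rect_eq; unfold translate, hull; cbn [xl xh yl yh]; unfold n; lia. }
assert (W3 : spanned start (Rect 0 (m + n) 0 (m + n))).
{ assert (S := spanned_translate 0 1 start_periodic W2).
  assert (S' := spanned_hull W2 S).
  match type of S' with _ -> spanned _ ?u => replace (Rect 0 (m + n) 0 (m + n)) with u end.
  - apply S'; unfold near, gap, translate; cbn [xl xh yl yh]; unfold n; lia.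
  - apply rect_eq; unfold translate, hull; cbn [xl xh yl yh]; unfold n; lia. }
destruct (spanned_everywhere n3 start_periodic W3) as [t [_ E _]].
- unfold width; cbn; lia.
- unfold height; cbn; lia.
- exists t; exact E.
Qed.

End Construction.

Section Sizes.
Local Open Scope Z_scope.

Lemma slow_parameters m : 12 <= m -> exists c q h0,
  [/\ 0 <= c, 1 <= q, 1 <= h0 & 6 * c <= m] /\
  h0 + 2 * c + 1 + 3 * q = m /\
  13 * (m + 2) * (m + 2) - 200 * (m + 2) <= 18 * slow_time m c q.
Proof.
intros Hm; set (c := m / 6); set (q := (m - 2 * c - 2) / 3).
assert (c1 := Z.div_mod m 6); assert (c2 := Z.mod_pos_bound m 6).
assert (q1 := Z.div_mod (m - 2 * c - 2) 3); assert (q2 := Z.mod_pos_bound (m - 2 * c - 2) 3).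
fold c in c1; fold q in q1.
set (e := m mod 6) in *; set (f := (m - 2 * c - 2) mod 3) in *.
assert (me : m = 6 * c + e) by lia; assert (qf : 3 * q = 4 * c + e - 2 - f) by lia.
exists c, q, (m - 2 * c - 1 - 3 * q); split; [split; lia|split; [lia|]].
unfold slow_time.
assert (Q : 18 * (q * (2 * m - 3)) = 6 * (4 * c + e - 2 - f) * (2 * m - 3)) by (rewrite -qf; ring).
clearbody c q e f; subst m; nia.
Qed.

Theorem slow_periodic n : 14 <= n -> exists D t T,
  [/\ everywhere (wrap_mod n D) t, ~ plane_infected (wrap_mod n D) T 0 0, 0 <= T &
      13 * n * n - 200 * n <= 18 * T].
Proof.
intros Hn; destruct (@slow_parameters (n - 2)) as [c [q [h0 [[c0 q1 h1 mc] [mq B]]]]]; [lia|].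
replace (n - 2 + 2) with n in B by lia.
assert (m9 : 9 <= n - 2) by lia.
destruct (start_percolates c0 q1 h1 mc m9 mq) as [t E].
assert (S := slow_origin c0 q1 h1 mc m9 mq).
unfold start in *; replace (n - 2 + 2) with n in * by lia.
exists (join (block (n - 2) c h0) (seed (n - 2) c q h0)), t, (slow_time (n - 2) c q).
split; auto; unfold slow_time; nia.
Qed.

End Sizes.

Require Import Defs.
From mathcomp Require Import all_boot all_order all_algebra.
From mathcomp Require Import all_classical all_reals all_analysis.
From mathcomp Require Import lra.
Import GRing.Theory Num.Theory numFieldNormedType.Exports.

Section Torus.
Local Open Scope Z_scope.
Variable N : nat.
Hypothesis N2 : (1 < N)%N.
Local Notation nz := (Z.of_nat N.+1).

Definition proj (x : Z) : 'I_N.+1 := inord (Z.to_nat (Z.modulo x nz)).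

Lemma nz_ge3 : Z.le 3 nz.
Proof. move/ltP: N2; lia. Qed.

Lemma proj_val x : Z.of_nat (nat_of_ord (proj x)) = Z.modulo x nz.
Proof.
have n3 := nz_ge3; have := Z.mod_pos_bound x nz => b.
rewrite /proj inordK; first lia.
by apply/ltP; lia.
Qed.

Lemma proj_eq x y : proj x = proj y <-> Z.modulo x nz = Z.modulo y nz.
Proof.
split=> [e|e]; first by rewrite -!proj_val e.
by apply/val_inj/Nat2Z.inj; rewrite /= !proj_val.
Qed.

Lemma proj_surj (i : 'I_N.+1) : exists2 x, i = proj x & Z.le 0 x /\ Z.lt x nz.
Proof.
have /ltP iN := ltn_ord i; exists (Z.of_nat i); last lia.
by apply/val_inj/Nat2Z.inj; rewrite /= proj_val Z.mod_small; lia.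
Qed.

Lemma proj_add x k : proj (x + k * nz) = proj x.
Proof. by apply/proj_eq; rewrite Z.mod_add //; have := nz_ge3; lia. Qed.

Lemma ordS_proj x : ordS (proj x) = proj (x + 1).
Proof.
have n3 := nz_ge3.
apply/val_inj/Nat2Z.inj => /=; rewrite proj_val.
have -> : Z.modulo (x + 1) nz = Z.modulo (Z.modulo x nz + 1) nz.
  by rewrite Z.add_mod_idemp_l; lia.
rewrite -(proj_val x); have /ltP := ltn_ord (proj x).
case: (eqVneq (proj x).+1%N N.+1) => [e _|ne].
  rewrite e modnn.
  have -> : (Z.of_nat (proj x) + 1 = nz) by lia.
  by rewrite Z.mod_same; lia.
move=> l; have {}ne : (proj x).+1%N <> N.+1%N by move=> e; rewrite e eqxx in ne.
rewrite modn_small; last by apply/ltP; lia.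
by rewrite Z.mod_small; lia.
Qed.

Lemma proj_inj x y : Z.lt (Z.abs (x - y)) nz -> proj x = proj y -> x = y.
Proof.
have n3 := nz_ge3 => l /proj_eq e.
have := Z.div_mod x nz; have := Z.div_mod y nz; rewrite e => H1 H2.
have : (x - y = nz * (Z.div x nz - Z.div y nz)) by lia.
case: (Z.eq_dec (Z.div x nz) (Z.div y nz)) => [-> | ne]; first lia.
by nia.
Qed.

Lemma cycle_adj_proj x j :
  cycle_adj (proj x) j <-> j = proj (x - 1) \/ j = proj (x + 1).
Proof.
have n3 := nz_ge3; rewrite /cycle_adj ordS_proj; split.
  case/andP=> _ /orP[/eqP -> | /eqP e]; [by right | left].
  case: (proj_surj j) e => z -> _; rewrite ordS_proj => /proj_eq e.
  apply/proj_eq; rewrite -(Zminus_mod_idemp_l x) e Zminus_mod_idemp_l.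
  by congr Z.modulo; lia.
case=> ->.
  rewrite ordS_proj (_ : (x - 1 + 1) = x) ?eqxx ?orbT ?andbT; last by lia.
  by apply/eqP => /proj_inj; lia.
by rewrite eqxx andbT; apply/eqP => /proj_inj; lia.
Qed.

Definition torus_lift (A : {set torus N.+1}) (x y : Z) : Prop := (proj x, proj y) \in A.

Lemma torus_adj_proj x y (u : torus N.+1) : torus_adj (proj x, proj y) u <->
  [\/ u = (proj (x - 1), proj y), u = (proj (x + 1), proj y),
      u = (proj x, proj (y - 1)) | u = (proj x, proj (y + 1))].
Proof.
rewrite /torus_adj /=; case: u => i j /=; split.
  case/orP=> /andP[].
    by move=> /cycle_adj_proj [->|->] /eqP <-; [constructor 1|constructor 2].
  by move=> /eqP <- /cycle_adj_proj [->|->]; [constructor 3|constructor 4].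
case=> -[-> ->]; rewrite eqxx /= ?andbT.
- by apply/orP; left; apply/cycle_adj_proj; left.
- by apply/orP; left; apply/cycle_adj_proj; right.
- by apply/orP; right; apply/cycle_adj_proj; left.
- by apply/orP; right; apply/cycle_adj_proj; right.
Qed.

Lemma torus_lift_step (A : {set torus N.+1}) x y :
  torus_lift (bootstrap_step (@torus_adj _) 2 A) x y <->
  torus_lift A x y \/ two_nbrs (torus_lift A) x y.
Proof.
have n3 := nz_ge3.
rewrite {1}/torus_lift /bootstrap_step finset.in_setU inE; split.
  case/orP=> [H|H]; [by left | right; move: H].
  case/card_gt1P => u [v [iu iv ne]].
  move: iu iv; rewrite !inE => /andP[uA /torus_adj_proj au] /andP[vA /torus_adj_proj av].
  rewrite /two_nbrs /torus_lift.
  by case: au uA ne => -> uA; case: av vA => -> vA; rewrite ?eqxx // => _; tauto.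
have ne1 z : proj (z - 1) <> proj (z + 1) by move/proj_inj; lia.
have ne2 z : proj (z - 1) <> proj z by move/proj_inj; lia.
have ne3 z : proj (z + 1) <> proj z by move/proj_inj; lia.
case=> [H|H]; apply/orP; [by left | right].
have gt1 u v : torus_adj (proj x, proj y) u -> torus_adj (proj x, proj y) v ->
    u \in A -> v \in A -> u <> v ->
    (2 <= #|[set u0 in A | torus_adj (proj x, proj y) u0]|)%N.
  move=> au av uA vA ne; apply/card_gt1P; exists u, v.
  by split; rewrite ?inE ?uA ?vA ?au ?av //; apply/eqP.
have a1 : torus_adj (proj x, proj y) (proj (x - 1), proj y) by apply/torus_adj_proj; constructor 1.
have a2 : torus_adj (proj x, proj y) (proj (x + 1), proj y) by apply/torus_adj_proj; constructor 2.
have a3 : torus_adj (proj x, proj y) (proj x, proj (y - 1)) by apply/torus_adj_proj; constructor 3.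
have a4 : torus_adj (proj x, proj y) (proj x, proj (y + 1)) by apply/torus_adj_proj; constructor 4.
case: H => [[h1 h2]|[[h1 h2]|[[h1 h2]|[[h1 h2]|[[h1 h2]|[h1 h2]]]]]].
- by apply: (gt1 _ _ a1 a2) => // -[/ne1].
- by apply: (gt1 _ _ a3 a4) => // -[/ne1].
- by apply: (gt1 _ _ a1 a3) => // -[/ne2].
- by apply: (gt1 _ _ a1 a4) => // -[/ne2].
- by apply: (gt1 _ _ a2 a3) => // -[/ne3].
- by apply: (gt1 _ _ a2 a4) => // -[/ne3].
Qed.

Lemma torus_lift_infected (A : {set torus N.+1}) t x y :
  torus_lift (infected (@torus_adj _) 2 A t) x y <-> plane_iter (torus_lift A) t x y.
Proof.
elim: t x y => [|t IH] x y //; rewrite /infected iterS torus_lift_step /=.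
split=> -[H|H]; [left|right|left|right]; try exact/IH.
  by apply: two_nbrs_mono H => u v; apply (IH u v).
by apply: two_nbrs_mono H => u v; apply (IH u v).
Qed.

Lemma torus_lift_periodic (A : {set torus N.+1}) : doubly_periodic nz (torus_lift A).
Proof. by move=> k l x y; rewrite /torus_lift !proj_add. Qed.

Lemma infected_everywhere (A : {set torus N.+1}) t :
  infected (@torus_adj _) 2 A t == [set: _] <-> everywhere (torus_lift A) (Z.of_nat t).
Proof.
split=> [/eqP e x y | E].
  by rewrite /plane_infected Nat2Z.id; apply/torus_lift_infected; rewrite e /torus_lift inE.
apply/eqP/setP => -[i j]; rewrite inE.
case: (proj_surj i) => x -> _; case: (proj_surj j) => y -> _.
by apply/(torus_lift_infected A t x y); have := E x y; rewrite /plane_infected Nat2Z.id.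
Qed.

Lemma percolation_timeP (A : {set torus N.+1}) (T : nat) :
  infected (@torus_adj _) 2 A T == [set: _] ->
  (percolation_time (@torus_adj _) 2 A <= T)%N.
Proof.
move=> H; rewrite /percolation_time; case: pselect => [pA|//].
by case: ex_minnP => m _; apply.
Qed.

Lemma MT_upper : Z.le (18 * Z.of_nat (MT N.+1)) (13 * nz * nz + 720 * nz).
Proof.
set b := Z.div (13 * nz * nz + 720 * nz) 18.
have n3 := nz_ge3.
have b0 : Z.le 0 b by apply Z.div_pos; lia.
have rect_bound := Z.mul_div_le (13 * nz * nz + 720 * nz) 18.
have bl : forall t, Z.le (18 * t) (13 * nz * nz + 720 * nz) -> Z.le t b.
  by move=> t Ht; apply: Z.div_le_lower_bound; lia.
suff : (MT N.+1 <= Z.to_nat b)%N by move/leP; lia.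
rewrite /MT /max_percolation_time; apply/bigmax_leqP => A /asboolP [t /infected_everywhere E].
case: (periodic_upper_bound n3 (@torus_lift_periodic A) E) => t' [t0 E' Ht'].
apply: (@leq_trans (Z.to_nat t')); last by apply/leP; have := bl _ Ht'; lia.
apply/percolation_timeP/infected_everywhere; rewrite Z2Nat.id //.
Qed.

Lemma MT_lower (A : {set torus N.+1}) (T : nat) (t : Z) x y :
  everywhere (torus_lift A) t -> ~ plane_infected (torus_lift A) (Z.of_nat T) x y ->
  (T < MT N.+1)%N.
Proof.
move=> E no.
have pA : percolates (@torus_adj N.+1) 2 A.
  exists (Z.to_nat t); apply/infected_everywhere => u v; apply: infected_le (E u v); lia.
apply: (@leq_trans (percolation_time (@torus_adj _) 2 A)); last first.
  by apply: (bigmax_sup A) => //; apply/asboolP.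
rewrite ltnNge; apply/negP => le; apply: no.
rewrite /percolation_time in le; case: pselect le => [pA'|] //.
case: ex_minnP => m /infected_everywhere Em _ /leP le.
by apply: infected_le (Em x y); lia.
Qed.

End Torus.

Local Open Scope classical_set_scope.
Local Open Scope ring_scope.

Section Bounds.
Local Open Scope Z_scope.

Lemma MT_lower_bound (N : nat) : 14 <= Z.of_nat N.+1 ->
  13 * Z.of_nat N.+1 * Z.of_nat N.+1 - 200 * Z.of_nat N.+1 <= 18 * Z.of_nat (MT N.+1).
Proof.
move=> n14; have N2 : (1 < N)%N by apply/ltP; lia.
case: (slow_periodic n14) => D [t [T [E no T0 B]]].
pose A : {set torus N.+1} := [set v : torus N.+1 | `[< D (Z.of_nat v.1) (Z.of_nat v.2) >]]%SET.
have liftA x y : torus_lift A x y <-> wrap_mod (Z.of_nat N.+1) D x y.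
  rewrite /torus_lift /wrap_mod inE /= !proj_val //.
  by split=> [/asboolP|?]; last apply/asboolP.
suff : (Z.to_nat T < MT N.+1)%N by move/ltP; lia.
apply: (MT_lower N2 (A := A) (t := t) (x := 0) (y := 0)).
  by move=> x y; apply: infected_ext (E x y) => u v; rewrite liftA.
by rewrite Z2Nat.id // => i; apply: no; apply: infected_ext i => u v; rewrite liftA.
Qed.

End Bounds.

Lemma MT_bounds n : (14 <= n)%N ->
  (13 * n * n <= 18 * MT n + 720 * n)%N /\ (18 * MT n <= 13 * n * n + 720 * n)%N.
Proof.
case: n => // N /leP n14; have N2 : (1 < N)%N by apply/ltP; lia.
have := @MT_lower_bound N; have := MT_upper N2.
rewrite -!plusE -!multE => u l; split; apply/leP; lia.
Qed.

Lemma scaled_bound (R : realType) (M n K : nat) :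
  (13 * n * n <= 18 * M + K * n)%N -> (18 * M <= 13 * n * n + K * n)%N ->
  `|M%:R - 13%:R / 18%:R * n%:R ^+ 2| <= K%:R * n%:R :> R.
Proof.
rewrite -(ler_nat R) natrD !natrM => lo; rewrite -(ler_nat R) natrD !natrM => up.
have p : 0 <= K%:R * n%:R :> R by rewrite mulr_ge0.
move: lo up p; set a := M%:R; set b := n%:R; set c := K%:R * b => lo up p.
by rewrite ler_norml; apply/andP; split; lra.
Qed.

Theorem theorem16 (R : realType) :
  (fun n : nat => (MT n)%:R : R) =
  (fun n : nat => 13%:R / 18%:R * n%:R ^+ 2 : R)
    +O_\oo (fun n : nat => n%:R : R).
Proof.
apply/eqaddOP.
have [K bounds] : exists K, forall n, (14 <= n)%N ->
    (13 * n * n <= 18 * MT n + K * n)%N /\ (18 * MT n <= 13 * n * n + K * n)%N.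
  by exists 720; exact: MT_bounds.
near=> k; near=> n.
have n14 : (14 <= n)%N by near: n; exact: nbhs_infty_ge.
have [lo up] := bounds n n14.
have kK : K%:R <= k by near: k; exact: nbhs_pinfty_ge.
rewrite (ger0_norm (ler0n _ _)).
apply: (@Order.POrderTheory.le_trans _ _ (K%:R * n%:R)); last by rewrite ler_wpM2r.
exact: scaled_bound.
Unshelve. all: by end_near.
Qed.
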